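(* For every integer $d\ge 1$, there is a group isomorphism $\operatorname{Out}(dV)\cong \operatorname{Out}(V)\wr S_d$, where the wreath product is taken with respect to the standard action of $S_d$ on $d$ points, i.e. $\operatorname{Out}(V)\wr S_d=\operatorname{Out}(V)^d\rtimes S_d$ with $S_d$ permuting the coordinates.
   Context: Let $X_2=\{0,1\}$, let $X_2^*$ be the set of finite words over $X_2$ (including the empty word) and let $\mathfrak{C}_2=X_2^\omega$ be Cantor space with the product topology. For $w\in (X_2^* )^d$ the cone $w\mathfrak{C}_2^d$ is the set of $x\in\mathfrak{C}_2^d$ such that, in each coordinate, $w$ is a prefix of $x$; if $x\in w\mathfrak{C}_2^d$ then $x-w$ denotes the unique $z\in\mathfrak{C}_2^d$ with $wz=x$ (coordinatewise concatenation). A finite set $F\subseteq (X_2^* )^d$ is a complete prefix code for $\mathfrak{C}_2^d$ if the cones $w\mathfrak{C}_2^d$, $w\in F$, partition $\mathfrak{C}_2^d$. Given complete prefix codes $F_1,F_2$ and a bijection $\phi:F_1\to F_2$, the prefix exchange map $f_\phi:\mathfrak{C}_2^d\to\mathfrak{C}_2^d$ sends $x\in w\mathfrak{C}_2^d$ (with $w\in F_1$) to $(w\phi)(x-w)$. The group $dV$ (Brin–Thompson group) is the group, under composition, of all such prefix exchange maps; $V=1V$ is Thompson's group $V$. $\operatorname{Out}$ denotes the outer automorphism group and $S_d$ the symmetric group on $d$ points. *)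

(* Defs.v *)
From HB Require Import structures.
From mathcomp Require Import all_boot all_fingroup finmap.
From mathcomp Require Import boolp classical_sets reals topology cantor.

Set Implicit Arguments.
Unset Strict Implicit.
Unset Printing Implicit Defensive.

(* All maps act on the right: in dV d, aut G and 'S_d, the product f * g is   *)
(* "f, then g"; inner automorphisms are x |-> x ^ y = y^-1 * (x * y).         *)

Definition cantor_pow (d : nat) : Type :=
  prod_topology (fun _ : 'I_d => cantor_space).

HB.instance Definition _ d := Pointed.on (cantor_pow d).
HB.instance Definition _ d := Nbhs.on (cantor_pow d).
HB.instance Definition _ d := Topological.on (cantor_pow d).
HB.instance Definition _ d := Uniform.on (cantor_pow d).

Definition words (d : nat) := {ffun 'I_d -> seq bool}.

Section PrefixExchange.
Local Open Scope classical_set_scope.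
Variable d : nat.
Implicit Types (w u v : words d) (x z : cantor_pow d) (F : {fset words d}).

Definition prepend w z : cantor_pow d :=
  fun i n => if (n < size (w i))%N then nth false (w i) n
             else z i (n - size (w i))%N.
Local Notation "w ** z" := (prepend w z) (at level 40).

Definition cone w : set (cantor_pow d) :=
  [set x | forall i, mkseq (x i) (size (w i)) = w i].

(* The point x - w: by prependK and stripK, if x is in the cone of w then      *)
(* strip w x is the unique z such that w ** z = x.                            *)
Definition strip w x : cantor_pow d := fun i n => x i (size (w i) + n)%N.

Definition complete_prefix_code F :=
  partition [set` F] cone [set: cantor_pow d].

Definition is_prefix_exchange (F1 F2 : {fset words d}) (phi : F1 -> F2)
    (f : cantor_pow d -> cantor_pow d) :=
  forall (w : F1) x, cone (val w) x -> f x = val (phi w) ** strip (val w) x.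

Definition prefix_exchange_map (f : cantor_pow d -> cantor_pow d) :=
  exists (F1 F2 : {fset words d}) (phi : F1 -> F2),
    [/\ complete_prefix_code F1, complete_prefix_code F2,
        bijective phi & is_prefix_exchange phi f].

Lemma coneP w x i n : cone w x -> (n < size (w i))%N -> x i n = nth false (w i) n.
Proof. by move=> /(_ i) <-; rewrite size_mkseq => ltn; rewrite nth_mkseq. Qed.

Lemma coneI w x :
  (forall i n, (n < size (w i))%N -> x i n = nth false (w i) n) -> cone w x.
Proof.
move=> H i; apply: (@eq_from_nth _ false); rewrite size_mkseq // => n ltn.
by rewrite nth_mkseq // H.
Qed.

Lemma prepend_cone w z : cone w (w ** z).
Proof. by apply: coneI => i n ltn; rewrite /prepend ltn. Qed.

Lemma prependK w : cancel (prepend w) (strip w).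
Proof.
move=> z; apply: funext => i; apply: funext => n.
by rewrite /strip /prepend ltnNge leq_addr addKn.
Qed.

Lemma stripK w x : cone w x -> w ** strip w x = x.
Proof.
move=> wx; apply: funext => i; apply: funext => n.
rewrite /prepend; case: ltnP => [/(coneP wx)->//|le].
by rewrite /strip subnKC.
Qed.

Definition wcat w v : words d := [ffun i => w i ++ v i].
Definition wdrop w v : words d := [ffun i => drop (size (w i)) (v i)].

Lemma prepend_cat w v z : wcat w v ** z = w ** (v ** z).
Proof.
apply: funext => i; apply: funext => n.
rewrite /prepend ffunE size_cat nth_cat; case: (ltnP n (size (w i))) => ltn.
  by rewrite (leq_trans ltn (leq_addr _ _)).
by rewrite ltn_subLR // subnDA.
Qed.

Lemma wdropK w v z : (forall i, size (w i) <= size (v i))%N ->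
  cone w (v ** z) -> wcat w (wdrop w v) = v.
Proof.
move=> le wv; apply/ffunP => i; rewrite !ffunE.
rewrite -[RHS](cat_take_drop (size (w i))); congr (_ ++ _).
apply: (@eq_from_nth _ false); first by rewrite size_takel.
move=> n ltn; rewrite nth_take // -(coneP wv) // /prepend.
by rewrite (leq_trans ltn (le i)).
Qed.

Lemma code_ex F x : complete_prefix_code F -> exists2 w, w \in F & cone w x.
Proof.
case=> cov _ _; have : [set: cantor_pow d] x by [].
by rewrite -cov => -[w wF wx]; exists w.
Qed.

Lemma code_inj F w v x : complete_prefix_code F ->
  w \in F -> v \in F -> cone w x -> cone v x -> w = v.
Proof. by case=> _ triv _ wF vF wx vx; apply: triv => //; exists x. Qed.

Definition cubes n : {fset words d} :=
  [fset ([ffun i => tval (t i)] : words d)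
    | t : {ffun 'I_d -> n.-tuple bool} in predT]%fset.

Lemma cubesP n w : reflect (forall i, size (w i) = n) (w \in cubes n).
Proof.
apply: (iffP idP) => [/imfsetP[t _ ->] i|sz]; first by rewrite ffunE size_tuple.
apply/imfsetP; exists [ffun i => insubd [tuple of nseq n false] (w i)] => //.
by apply/ffunP => i; rewrite !ffunE val_insubd sz eqxx.
Qed.

Lemma cubes_code n : complete_prefix_code (cubes n).
Proof.
split.
- apply/seteqP; split => // x _.
  exists [ffun i => mkseq (x i) n] => /=.
    by apply/cubesP => i; rewrite ffunE size_mkseq.
  by move=> i; rewrite ffunE size_mkseq.
- move=> w v /= /cubesP wn /cubesP vn [x [wx vx]].
  by apply/ffunP => i; rewrite -wx -vx wn vn.
- by move=> w _; exists (w ** point); apply: prepend_cone.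
Qed.

Lemma code_bound F : exists n, forall w, w \in F -> forall i, (size (w i) <= n)%N.
Proof.
exists (\max_(w <- enum_fset F) \max_i size (w i))%N => w wF i.
apply: (@leq_trans (\max_i size (w i))%N).
  exact: (@leq_bigmax _ (fun i => size (w i))).
exact: (@leq_bigmax_seq _ _ _ (fun w : words d => \max_i size (w i))%N).
Qed.

Lemma prefix_exchangeP f : prefix_exchange_map f <->
  bijective f /\ exists n, forall w, (forall i, (n <= size (w i))%N) ->
    exists w', (forall i, (size (w i) <= size (w' i) + n)%N) /\
               forall z, f (w ** z) = w' ** z.
Proof.
split.
- move=> [F1 [F2 [phi [c1 c2 [psi phiK psiK] fE]]]]; split; last first.
    have [n nP] := code_bound F1; exists n => w wn.
    have [v vF vw] := code_ex (w ** point) c1.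
    pose v' := phi [` vF]%fset.
    have vle i : (size (v i) <= size (w i))%N.
      exact: leq_trans (nP v vF i) (wn i).
    exists (wcat (val v') (wdrop v w)); split => [i|z].
      rewrite !ffunE size_cat size_drop -{1}(subnK (vle i)) -addnA addnCA.
      by rewrite leq_add2l (leq_trans (nP v vF i)) // leq_addl.
    rewrite -{1}(wdropK vle vw) prepend_cat.
    rewrite (fE [` vF]%fset) /=; last exact: prepend_cone.
    by rewrite prependK prepend_cat.
  have ex x : exists y, exists2 w : F2, cone (val w) x &
     y = val (psi w) ** strip (val w) x.
    have [w wF wx] := code_ex x c2.
    by exists (val (psi [` wF]%fset) ** strip w x); exists [` wF]%fset.
  have [g gP] := choice ex; exists g => x.
    have [v vF vx] := code_ex x c1.
    have [w wfx ->] := gP (f x).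
    have fx := fE [` vF]%fset x vx.
    have ew : w = phi [` vF]%fset.
      apply/val_inj/(code_inj c2 (valP w) (valP _) wfx).
      by rewrite fx; apply: prepend_cone.
    by rewrite ew phiK fx prependK stripK.
  have [w wx ->] := gP x.
  by rewrite (fE (psi w)) ?prependK ?psiK ?stripK //; apply: prepend_cone.
- move=> [[g fK gK] [n nP]].
  have ex (w : words d) : exists w', w \in cubes n -> forall z, f (w ** z) = w' ** z.
    have [wn|wn] := boolP (w \in cubes n); last by exists w.
    have [|w' [_ w'P]] := nP w; first by move=> i; rewrite (cubesP _ _ wn).
    by exists w'.
  have [h hP] := choice ex.
  have cw w x : w \in cubes n -> cone (h w) (f x) <-> cone w x.
    move=> wn; split=> wx; last first.
      by rewrite -(stripK wx) hP //; apply: prepend_cone.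
    have := stripK wx; rewrite -hP // => /(can_inj fK) <-.
    exact: prepend_cone.
  pose F2 := [fset h w | w in cubes n]%fset.
  have hF (w : cubes n) : h (val w) \in F2 by apply/in_imfset/(valP w).
  exists (cubes n), F2, (fun w : cubes n => [` hF w]%fset); split.
  + exact: cubes_code.
  + split.
    * apply/seteqP; split => // x _.
      have [w wn wx] := code_ex (g x) (cubes_code n).
      exists (h w); first exact: in_imfset.
      by rewrite -(gK x); apply/cw.
    * move=> w v /= /imfsetP[/= w0 w0n ->] /imfsetP[/= v0 v0n ->] [x [wx vx]].
      rewrite -(gK x) in wx vx.
      congr h; apply: (code_inj (cubes_code n) w0n v0n).
        by apply/cw; eauto.
      by apply/cw; eauto.
    * by move=> w _; exists (w ** point); apply: prepend_cone.
  + have inj : injective (fun w : cubes n => [` hF w]%fset).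
      move=> w v /(congr1 val) /= e; apply: val_inj.
      apply: (code_inj (cubes_code n) (valP w) (valP v) (x := val w ** point)).
        exact: prepend_cone.
      apply/(cw _ _ (valP v)); rewrite -e; apply/(cw _ _ (valP w)).
      exact: prepend_cone.
    have surj (v : F2) : exists w : cubes n, [` hF w]%fset = v.
      have /imfsetP[/= w wn e] := valP v.
      by exists [` wn]%fset; apply: val_inj; rewrite /= e.
    have [k kP] := choice surj.
    by exists k => // w; apply: inj; rewrite kP.
  + by move=> w x wx /=; rewrite -{1}(stripK wx) hP //; apply: valP.
Qed.

Lemma prefix_exchange_id : prefix_exchange_map id.
Proof.
apply/prefix_exchangeP; split; first by exists id.
by exists 0%N => w _; exists w; split => // i; rewrite addn0.
Qed.

Lemma prefix_exchange_comp f g : prefix_exchange_map f ->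
  prefix_exchange_map g -> prefix_exchange_map (g \o f).
Proof.
move=> /prefix_exchangeP[bf [n nP]] /prefix_exchangeP[bg [m mP]].
apply/prefix_exchangeP; split; first exact: bij_comp.
exists (n + m)%N => w wnm.
have [i|w' [w's w'P]] := nP w; first exact: leq_trans (leq_addr _ _) (wnm i).
have [i|w'' [w''s w''P]] := mP w'.
  by rewrite -(leq_add2r n) addnC; apply: leq_trans (wnm i) (w's i).
exists w''; split => [i|z]; last by rewrite /= w'P w''P.
by rewrite addnCA addnC (leq_trans (w's i)) // leq_add2r.
Qed.

Lemma prefix_exchange_inv f : prefix_exchange_map f ->
  exists g, [/\ prefix_exchange_map g, cancel f g & cancel g f].
Proof.
move=> pf; have /prefix_exchangeP[[g fK gK] _] := pf.
exists g; split=> //.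
have [F1 [F2 [phi [c1 c2 [psi phiK psiK] fE]]]] := pf.
exists F2, F1, psi; split=> //; first by exists phi.
move=> w x wx; apply: (can_inj fK); rewrite gK (fE (psi w)).
  by rewrite prependK psiK stripK.
exact: prepend_cone.
Qed.

End PrefixExchange.

Record dV (d : nat) := PrefixExchange {
  dV_fun :> cantor_pow d -> cantor_pow d;
  dV_prefix_exchange : prefix_exchange_map dV_fun
}.

Section dVGroup.
Variable d : nat.
Implicit Types f g h : dV d.

Lemma dV_eq f g : f =1 g -> f = g.
Proof.
case: f g => [f pf] [g pg] /= /funext e; subst g.
by congr PrefixExchange; apply: Prop_irrelevance.
Qed.

HB.instance Definition _ := gen_eqMixin (dV d).
HB.instance Definition _ := gen_choiceMixin (dV d).

Definition dV_one : dV d := PrefixExchange (@prefix_exchange_id d).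

Definition dV_mul f g : dV d :=
  PrefixExchange
    (prefix_exchange_comp (dV_prefix_exchange f) (dV_prefix_exchange g)).

Lemma dV_inv_subproof f : {g : dV d | cancel f g /\ cancel g f}.
Proof.
apply: cid; have [g [pg fK gK]] := prefix_exchange_inv (dV_prefix_exchange f).
by exists (PrefixExchange pg).
Qed.

Definition dV_inv f : dV d := sval (dV_inv_subproof f).

Lemma dV_mulA : associative dV_mul. Proof. by move=> f g h; apply: dV_eq. Qed.
Lemma dV_mul1 : left_id dV_one dV_mul. Proof. by move=> f; apply: dV_eq. Qed.
Lemma dV_mul1r : right_id dV_one dV_mul. Proof. by move=> f; apply: dV_eq. Qed.

Lemma dV_mulV : left_inverse dV_one dV_inv dV_mul.
Proof.
by move=> f; apply: dV_eq; rewrite /dV_inv; case: dV_inv_subproof => g [].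
Qed.

Lemma dV_mulVr : right_inverse dV_one dV_inv dV_mul.
Proof.
by move=> f; apply: dV_eq; rewrite /dV_inv; case: dV_inv_subproof => g [].
Qed.

HB.instance Definition _ :=
  isGroup.Build (dV d) dV_mulA dV_mul1 dV_mul1r dV_mulV dV_mulVr.

End dVGroup.

Definition V := dV 1.
HB.instance Definition _ := Group.on V.

Local Open Scope group_scope.

Record aut (G : groupType) := Aut {
  aut_val :> {multiplicative G -> G};
  aut_bij : bijective aut_val
}.

Section AutGroup.
Variable G : groupType.
Implicit Types a b c : aut G.

Lemma aut_eq a b : a =1 b -> a = b.
Proof.
case: a b => [[a [[pa]]] ba] [[b [[pb]]] bb] /= /funext e; subst b.
have e : pa = pb by apply: Prop_irrelevance.
by subst pb; congr Aut; apply: Prop_irrelevance.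
Qed.

HB.instance Definition _ := gen_eqMixin (aut G).
HB.instance Definition _ := gen_choiceMixin (aut G).

Definition aut_one : aut G :=
  @Aut G (@idfun G) (Bijective (fun x => erefl x) (fun x => erefl x)).

Definition aut_mul a b : aut G :=
  @Aut G (aut_val b \o aut_val a) (bij_comp (aut_bij b) (aut_bij a)).

Lemma aut_inv_subproof a : {b : aut G | cancel a b /\ cancel b a}.
Proof.
apply: cid; have [b aK bK] := aut_bij a.
have bM : {morph b : x y / x * y}.
  by move=> x y; apply: (can_inj aK); rewrite gmulfM !bK.
pose B := isMultiplicative.Build G G b bM.
pose b' : {multiplicative G -> G} := HB.pack b B.
have bij : bijective b' by exists a.
by exists (Aut bij).
Qed.

Definition aut_inv a : aut G := sval (aut_inv_subproof a).

Lemma aut_mulA : associative aut_mul. Proof. by move=> a b c; apply: aut_eq. Qed.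
Lemma aut_mul1 : left_id aut_one aut_mul. Proof. by move=> a; apply: aut_eq. Qed.
Lemma aut_mul1r : right_id aut_one aut_mul. Proof. by move=> a; apply: aut_eq. Qed.

Lemma aut_mulV : left_inverse aut_one aut_inv aut_mul.
Proof.
by move=> a; apply: aut_eq; rewrite /aut_inv; case: aut_inv_subproof => b [].
Qed.

Lemma aut_mulVr : right_inverse aut_one aut_inv aut_mul.
Proof.
by move=> a; apply: aut_eq; rewrite /aut_inv; case: aut_inv_subproof => b [].
Qed.

HB.instance Definition _ :=
  isGroup.Build (aut G) aut_mulA aut_mul1 aut_mul1r aut_mulV aut_mulVr.

Lemma autME a b x : (a * b) x = b (a x). Proof. by []. Qed.
Lemma aut1E x : (1 : aut G) x = x. Proof. by []. Qed.

Lemma autKV a : cancel a (a^-1 : aut G).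
Proof. by move=> x; rewrite -autME mulgV. Qed.

Lemma autVK a : cancel (a^-1 : aut G) a.
Proof. by move=> x; rewrite -autME mulVg. Qed.

Lemma aut_conjg a x y : a (x ^ y) = a x ^ a y.
Proof. by apply: (mulgI (a y)); rewrite -gmulfM -!conjgC gmulfM. Qed.

Definition inner a : Prop := exists y, forall x, a x = x ^ y.

Lemma inner1 : inner 1.
Proof. by exists 1 => x; rewrite conjg1. Qed.

Lemma innerM a b : inner a -> inner b -> inner (a * b).
Proof.
by move=> [y ya] [z zb]; exists (y * z) => x; rewrite autME ya zb conjgM.
Qed.

Lemma innerV a : inner a -> inner a^-1.
Proof.
move=> [y ya]; exists y^-1 => x; apply: (can_inj (autKV a)).
by rewrite autVK ya conjgKV.
Qed.

Lemma innerJ a b : inner a -> inner (b^-1 * (a * b)).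
Proof.
by move=> [y ya]; exists (b y) => x; rewrite !autME ya aut_conjg autVK.
Qed.

(* The classes of out_rel are the cosets of the inner automorphisms, so that   *)
(* Out below is the quotient of aut G by them.                                *)
Definition out_rel : rel (aut G) := fun a b => `[< inner (a^-1 * b) >].

Lemma out_rel_refl : reflexive out_rel.
Proof. by move=> a; apply/asboolP; rewrite mulVg; apply: inner1. Qed.

Lemma out_rel_sym : symmetric out_rel.
Proof.
move=> a b; apply/asboolP/asboolP => /innerV; by rewrite invgM invgK.
Qed.

Lemma out_rel_trans : transitive out_rel.
Proof.
move=> b a c /asboolP ab /asboolP bc; apply/asboolP.
by have := innerM ab bc; rewrite mulgA -[a^-1 * b * _]mulgA mulgV mulg1.
Qed.

Canonical out_equiv := EquivRel out_rel out_rel_refl out_rel_sym out_rel_trans.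

Definition Out : Type := {eq_quot out_rel}%qT.
HB.instance Definition _ := Choice.on Out.
HB.instance Definition _ := EqQuotient.on Out.

Local Open Scope quotient_scope.
Local Notation rep := generic_quotient.repr.

Lemma OutP a b : reflect (\pi_Out a = \pi_Out b) (out_rel a b).
Proof. exact: (iffP (eqmodP _ a b)). Qed.

Definition Out_one : Out := \pi_Out 1.
Definition Out_mul (p q : Out) : Out := \pi_Out (rep p * rep q).
Definition Out_inv (p : Out) : Out := \pi_Out (rep p)^-1.

Lemma pi_OutM a b : \pi_Out (a * b) = Out_mul (\pi_Out a) (\pi_Out b).
Proof.
apply/OutP/asboolP.
have /OutP/asboolP ia : \pi_Out a = \pi_Out (rep (\pi_Out a)) by rewrite reprK.
have /OutP/asboolP ib : \pi_Out b = \pi_Out (rep (\pi_Out b)) by rewrite reprK.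
have := innerM (innerJ b ia) ib.
by rewrite invgM !mulgA -[_ * b * b^-1]mulgA mulgV mulg1.
Qed.

Lemma pi_OutV a : \pi_Out a^-1 = Out_inv (\pi_Out a).
Proof.
apply/OutP/asboolP.
have /OutP/asboolP ia : \pi_Out a = \pi_Out (rep (\pi_Out a)) by rewrite reprK.
have := innerJ (a^-1) (innerV ia).
by rewrite invgM !invgK !mulgA -[_ * a * a^-1]mulgA mulgV mulg1.
Qed.

Lemma Out_mulA : associative Out_mul.
Proof.
move=> p q r; rewrite -[p]reprK -[q]reprK -[r]reprK.
move: (rep p) (rep q) (rep r) => a b c.
by rewrite -(pi_OutM b c) -(pi_OutM a) -(pi_OutM a b) -(pi_OutM _ c) mulgA.
Qed.

Lemma Out_mul1 : left_id Out_one Out_mul.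
Proof. by move=> p; rewrite -[p]reprK /Out_one -pi_OutM mul1g. Qed.

Lemma Out_mul1r : right_id Out_one Out_mul.
Proof. by move=> p; rewrite -[p]reprK /Out_one -pi_OutM mulg1. Qed.

Lemma Out_mulV : left_inverse Out_one Out_inv Out_mul.
Proof. by move=> p; rewrite -[p]reprK -pi_OutV -pi_OutM mulVg. Qed.

Lemma Out_mulVr : right_inverse Out_one Out_inv Out_mul.
Proof. by move=> p; rewrite -[p]reprK -pi_OutV -pi_OutM mulgV. Qed.

HB.instance Definition _ :=
  isGroup.Build Out Out_mulA Out_mul1 Out_mul1r Out_mulV Out_mulVr.

End AutGroup.

Definition wreath (G : groupType) (d : nat) : Type :=
  ({ffun 'I_d -> G} * 'S_d)%type.
HB.instance Definition _ G d := Choice.on (wreath G d).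

Section WreathGroup.
Variables (G : groupType) (d : nat).
Implicit Types (a : {ffun 'I_d -> G}) (s t : 'S_d) (p q : wreath G d).

(* With the product of 'S_d given by (s * t) i = t (s i), this is a left      *)
(* action of 'S_d on G^d by group automorphisms.                              *)
Definition wreath_act s a : {ffun 'I_d -> G} := [ffun i => a (s i)].

Definition wreath_one : wreath G d := (1, 1).
Definition wreath_mul p q : wreath G d :=
  (p.1 * wreath_act p.2 q.1, p.2 * q.2).
Definition wreath_inv p : wreath G d := (wreath_act p.2^-1 p.1^-1, p.2^-1).

Lemma wreath_mulA : associative wreath_mul.
Proof.
move=> p q r; congr pair; last exact: mulgA.
by apply/ffunP => i; rewrite !ffunE mulgA permM.
Qed.

Lemma wreath_mul1 : left_id wreath_one wreath_mul.
Proof.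
move=> [a s]; congr pair; last exact: mul1g.
by apply/ffunP => i; rewrite !ffunE perm1 mul1g.
Qed.

Lemma wreath_mul1r : right_id wreath_one wreath_mul.
Proof.
move=> [a s]; congr pair; last exact: mulg1.
by apply/ffunP => i; rewrite !ffunE mulg1.
Qed.

Lemma wreath_mulV : left_inverse wreath_one wreath_inv wreath_mul.
Proof.
move=> [a s]; congr pair; last exact: mulVg.
by apply/ffunP => i; rewrite !ffunE mulVg.
Qed.

Lemma wreath_mulVr : right_inverse wreath_one wreath_inv wreath_mul.
Proof.
move=> [a s]; congr pair; last exact: mulgV.
by apply/ffunP => i; rewrite !ffunE permK mulgV.
Qed.

End WreathGroup.

HB.instance Definition _ G d := isGroup.Build (wreath G d)
  (@wreath_mulA G d) (@wreath_mul1 G d) (@wreath_mul1r G d)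
  (@wreath_mulV G d) (@wreath_mulVr G d).

(* Main.v *)
Require Import Defs.
From HB Require Import structures.
From mathcomp Require Import all_boot all_fingroup.
From mathcomp Require Import boolp classical_sets.
From mathcomp Require Import zify.
(* all_fingroup has its own [aut]; the second import restores the one of Defs. *)
Require Import Defs.

(* Every automorphism a of dV is conjugation by a homeomorphism h (Rubin):    *)
(* for an involution p, the elements supported in supp p are characterized    *)
(* by commutation relations with p (Fremlin, Measure Theory 384), so a        *)
(* permutes the rigid stabilizers of clopen sets, hence the clopen sets.      *)
(* At the point 0 = (0^w, ..., 0^w) let g_i contract every coordinate but i.  *)
(* Its conjugate by h is a prefix exchange fixing h 0, and for every j one of *)
(* these conjugates is trivial in coordinate j near h 0. As g_i^m x tends to  *)
(* the projection of x to the i-th axis, coordinate j of h x depends near 0   *)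
(* on a single coordinate of x. Prefix exchanges move a neighbourhood of 0    *)
(* onto the whole space, so up to an element of dV, h is a product of         *)
(* homeomorphisms of Cantor space normalizing V, followed by a permutation    *)
(* of the coordinates. Conversely all such products normalize dV, because dV  *)
(* consists of the bijections that locally are products of prefix exchanges.  *)

Set Implicit Arguments.
Unset Strict Implicit.
Unset Printing Implicit Defensive.

(** * Local prefix exchanges *)

(** By [aut_spatial] every automorphism of dV is conjugation by a homeomorphism, and by
    [intertwiner_unique] the automorphism determines that homeomorphism. So Out(dV) is the group of
    homeomorphisms normalizing dV, modulo dV. [local_product] shows that near [zeros] such a
    homeomorphism is a product of one-variable maps up to reindexing. [product_form] turns this into
    a global statement modulo dV: the outer class has a representative that is conjugation by some
    [permprod k s]. Its factors [k i] then normalize V. The relation [realizes a p] says that [a] is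
    conjugation by such a product, with permutation and outer classes given by [p]. The isomorphism
    is this relation read on outer classes: it is total by [realizes_total], single-valued by
    [realizes_fun], injective by [realizes_outer_inj], surjective by [realizes_surj] and
    multiplicative by [realizesM]. Two facts about germs are used throughout: an element of dV acts
    near each point coordinate by coordinate ([dV_prefix_at]), and a bijection with such germs
    everywhere lies in dV ([prefix_at_dV]). *)

Definition agree d n (x y : cantor_pow d) :=
  forall i k, (k < n)%N -> x i k = y i k.

Section Agree.
Variable d : nat.
Implicit Types (x y z : cantor_pow d) (n m k : nat).

Lemma agreexx n x : agree n x x. Proof. by []. Qed.

Lemma agree_sym n x y : agree n x y -> agree n y x.
Proof. by move=> xy i k kn; rewrite xy. Qed.

Lemma agree_trans n x y z : agree n x y -> agree n y z -> agree n x z.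
Proof. by move=> xy yz i k kn; rewrite xy // yz. Qed.

Lemma agreeW m n x y : (m <= n)%N -> agree n x y -> agree m x y.
Proof. by move=> mn xy i k km; apply: xy; lia. Qed.

Lemma cantor_powP x y : (forall i k, x i k = y i k) -> x = y.
Proof. by move=> e; apply: funext => i; apply: funext => k; apply: e. Qed.

Lemma agree_eq x y : (forall n, agree n x y) -> x = y.
Proof. by move=> e; apply: cantor_powP => i k; apply: (e k.+1). Qed.

Lemma neq_agree x y : x <> y -> exists n, ~ agree n x y.
Proof.
move=> xy; apply: contrapT => /forallNP e; apply: xy; apply: agree_eq => n.
exact: contrapT (e n).
Qed.

End Agree.

(** Compactness in the form of König's lemma: a cube on which no single bound works contains a
    smaller such cube, and the limit point of the nested cubes contradicts the pointwise
    hypothesis. *)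
Lemma cantor_pow_uniform d (Q : nat -> cantor_pow d -> Prop) :
  (forall n x y, agree n x y -> Q n x -> Q n y) ->
  (forall m n x, (m <= n)%N -> Q m x -> Q n x) ->
  (forall x, exists n, Q n x) -> exists n, forall x, Q n x.
Proof.
move=> Qagree Qmono Qex; apply: contrapT => /forallNP nQ.
pose bad n x := forall m, exists2 y, agree n x y & ~ Q m y.
have bad0 : bad 0%N (fun _ _ => false).
  by move=> m; have /existsNP[y nQy] := nQ m; exists y.
have step nx : exists x', bad nx.1 nx.2 ->
    agree nx.1 nx.2 x' /\ bad nx.1.+1 x'.
  case: nx => n x /=; have [b|nb] := pselect (bad n x); last by exists x.
  (* Otherwise each one-letter extension of the cube admits a bound, and the maximum of these
     finitely many bounds serves the whole cube. *)
  apply: contrapT => /forallNP no.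
  pose ext (e : {ffun 'I_d -> bool}) : cantor_pow d :=
    fun i k => if k == n then e i else x i k.
  have aext e : agree n x (ext e).
    by move=> i k kn; rewrite /ext; case: eqP => //; lia.
  have good e : exists m, forall y, agree n.+1 (ext e) y -> Q m y.
    have := no (ext e); apply: contra_notP => /forallNP ng; split => //.
    by move=> m; have /existsNP[y /not_implyP[]] := ng m; exists y.
  have [M MP] := choice good.
  have [y xy nQy] := b (\max_e M e).
  pose e := [ffun i => y i n].
  apply/nQy/(Qmono (M e)); first exact: (@leq_bigmax _ M).
  apply: MP => i k kn; rewrite /ext; case: eqP => [->|ne]; first by rewrite ffunE.
  by apply: xy; lia.
have [F FP] := choice step.
pose s := fix s n : cantor_pow d := if n is n'.+1 then F (n', s n') else fun _ _ => false.
have sbad n : bad n (s n).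
  by elim: n => [|n IH] //=; have [] := FP (n, s n) IH.
have sagree n m : (n <= m)%N -> agree n (s n) (s m).
  elim: m => [|m IH]; first by rewrite leqn0 => /eqP->.
  rewrite leq_eqVlt ltnS => /orP[/eqP-> //|nm].
  apply: agree_trans (IH nm) _; apply: agreeW nm _.
  by have [] := FP (m, s m) (sbad m).
pose x : cantor_pow d := fun i k => s k.+1 i k.
have xs n : agree n x (s n) by move=> i k kn; apply: (sagree k.+1 n).
have [n Qx] := Qex x; have [y sy nQy] := sbad n n.
by apply/nQy/(Qagree _ _ _ _ Qx)/(agree_trans (xs n)).
Qed.

(** The germ of a prefix exchange: in coordinate [i], delete [a i] letters and write the first [b i]
    letters of [e]. Lengths together with a reference point replace words, so that compositions
    reduce to arithmetic. *)
Definition splice d (a b : 'I_d -> nat) (e x : cantor_pow d) : cantor_pow d :=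
  fun i k => if (k < b i)%N then e i k else x i (a i + (k - b i))%N.

Definition prefix_at d (f : cantor_pow d -> cantor_pow d) x :=
  exists a b e n, forall y, agree n x y -> f y = splice a b e y.

Definition continuous_at d (f : cantor_pow d -> cantor_pow d) x :=
  forall n, exists m, forall y, agree m x y -> agree n (f x) (f y).

Section LocalPrefix.
Variable d : nat.
Implicit Types (x y z e : cantor_pow d) (f g : cantor_pow d -> cantor_pow d).
Implicit Types (a b : 'I_d -> nat) (n m k : nat).

Lemma splice_base a b e x y : splice a b (splice a b e x) y = splice a b e y.
Proof. by apply: cantor_powP => i k; rewrite /splice; case: ltnP => // ->. Qed.

Lemma splice_comp a1 b1 e1 a2 b2 e2 x :
  splice a2 b2 e2 (splice a1 b1 e1 x) =
  splice (fun i => a1 i + (a2 i - b1 i))%N (fun i => b2 i + (b1 i - a2 i))%N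
    (splice a2 b2 e2 e1) x.
Proof.
apply: cantor_powP => i k; rewrite /splice.
have [k1|k1] := ltnP k (b2 i); first by case: ltnP => // k2; lia.
have [k2|k2] := ltnP (a2 i + (k - b2 i))%N (b1 i).
  by case: ltnP => // k3; lia.
by case: ltnP => [|k3]; [lia | congr (x i _); lia].
Qed.

Lemma le_maxfun a i : (a i <= \max_i a i)%N.
Proof. exact: (@leq_bigmax _ a). Qed.

Lemma splice_agree a b e n x y :
  agree ((\max_i a i) + n) x y -> agree n (splice a b e x) (splice a b e y).
Proof.
move=> xy i k kn; rewrite /splice; case: ltnP => // bk; apply: xy.
by have := le_maxfun a i; lia.
Qed.

Lemma prefix_at_continuous f x : prefix_at f x -> continuous_at f x.
Proof.
move=> [a [b [e [n fE]]]] m; exists (maxn n ((\max_i a i) + m)) => y xy.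
rewrite !fE //; last by apply: agreeW xy; lia.
by apply: splice_agree; apply: agreeW xy; lia.
Qed.

Lemma prefix_at_near f g x n : (forall y, agree n x y -> g y = f y) ->
  prefix_at f x -> prefix_at g x.
Proof.
move=> gf [a [b [e [m fE]]]]; exists a, b, e, (maxn n m) => y xy.
by rewrite gf ?fE //; apply: agreeW xy; lia.
Qed.

Lemma prefix_at_id x : prefix_at id x.
Proof.
exists (fun=> 0%N), (fun=> 0%N), x, 0%N => y _.
by apply: cantor_powP => i k; rewrite /splice add0n subn0.
Qed.

Lemma prefix_at_splice a b e x : prefix_at (splice a b e) x.
Proof. by exists a, b, e, 0%N. Qed.

Lemma prefix_at_comp f g x : prefix_at f x -> prefix_at g (f x) -> prefix_at (g \o f) x.
Proof.
move=> lf lg; have := prefix_at_continuous lf.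
case: lf lg => [a [b [e [n fE]]]] [a' [b' [e' [m gE]]]] /(_ m)[l fl].
eexists _, _, _, (maxn n l) => y xy /=.
rewrite gE; last by apply: fl; apply: agreeW xy; lia.
by rewrite fE; [exact: splice_comp | apply: agreeW xy; lia].
Qed.

(** Undoing the splice of [r] at [v y] after [f] gives a candidate [s] with
    [r (s y') = f y' = r (v y')] near [y]; injectivity of [r] forces [v = s] there. No continuity of
    [v] is assumed. *)
Lemma prefix_at_cancel (r v f : cantor_pow d -> cantor_pow d) y n : injective r ->
  (forall y', agree n y y' -> r (v y') = f y') ->
  prefix_at f y -> prefix_at r (v y) -> prefix_at v y.
Proof.
move=> rI rv lf [a [b [e [m rE]]]]; have fc := prefix_at_continuous lf.
pose s y' := splice b a (v y) (f y').
suff [l vs] : exists l, forall y', agree l y y' -> v y' = s y'.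
  by apply: prefix_at_near vs _; apply: (@prefix_at_comp f) => //; apply: prefix_at_splice.
have [l fl] := fc (m + \max_i b i)%N.
exists (maxn n l) => y' yy'; apply: rI.
have nyy' : agree n y y' by apply: agreeW yy'; lia.
have {}fl : agree (m + \max_i b i) (f y) (f y') by apply: fl; apply: agreeW yy'; lia.
have fyE : f y = splice a b e (v y) by rewrite -rv // rE.
rewrite rv // rE.
  apply: cantor_powP => i k; rewrite /splice /s; case: ltnP => bk.
    by rewrite -fl ?fyE /splice ?bk //; have := le_maxfun b i; lia.
  rewrite /splice; case: ltnP => ka; first by lia.
  by congr (f y' i _); lia.
move=> i k km; rewrite /s /splice; case: ltnP => // ak.
rewrite -fl; last by have := le_maxfun b i; lia.
rewrite fyE /splice; case: ltnP => [|bk]; first lia.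
by congr (v y i _); lia.
Qed.

Lemma dV_prefix_at (f : dV d) x : prefix_at f x.
Proof.
have /prefix_exchangeP[_ [n nP]] := dV_prefix_exchange f.
pose w : words d := [ffun i => mkseq (x i) n].
have [i|w' [_ fE]] := nP w; first by rewrite ffunE size_mkseq.
exists (fun=> n), (fun i => size (w' i)), (prepend w' x), n => y xy.
have wy : cone w y.
  apply: coneI => i k; rewrite ffunE size_mkseq => kn.
  by rewrite nth_mkseq // xy.
rewrite -{1}(stripK wy) fE; apply: cantor_powP => i k.
rewrite /splice /prepend /strip; case: ltnP => // _.
by rewrite ffunE size_mkseq.
Qed.

Lemma prefix_at_dV f : bijective f -> (forall x, prefix_at f x) -> prefix_exchange_map f.
Proof.
move=> bf lf; apply/prefix_exchangeP; split => //.
pose tr n x : words d := [ffun i => mkseq (x i) n].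
have trcone n x y : cone (tr n x) y <-> agree n x y.
  split=> [xy i k kn|xy].
    by have := coneP (i := i) (n := k) xy; rewrite ffunE size_mkseq nth_mkseq // => ->.
  by apply: coneI => i k; rewrite ffunE size_mkseq => kn; rewrite nth_mkseq // xy.
pose Q n x := exists w', forall z, f (prepend (tr n x) z) = prepend w' z.
have [||x|n nP] := @cantor_pow_uniform d Q.
- move=> n x y xy [w' wE]; exists w' => z; rewrite -wE; congr (f (prepend _ z)).
  by apply/ffunP => i; rewrite !ffunE; apply/eq_in_map => k; rewrite mem_iota => kn; rewrite xy.
- move=> m n x mn [w' wE]; exists (wcat w' (wdrop (tr m x) (tr n x))) => z.
  rewrite prepend_cat -wE -prepend_cat (@wdropK _ _ _ z) //.
    by move=> i; rewrite !ffunE !size_mkseq.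
  apply/trcone => i k km; rewrite /prepend ffunE size_mkseq.
  by case: ltnP => kn; [rewrite nth_mkseq | lia].
(* The depth covers both the neighbourhood where the germ is valid and the letters that [splice]
   deletes. *)
- have [a [b [e [n fE]]]] := lf x; exists (maxn n (\max_i a i)).
  set N := maxn _ _; exists [ffun i => mkseq (f x i) (b i + (N - a i))] => z.
  set y := prepend _ z.
  have xy : agree N x y.
    move=> i k kN; rewrite /y /prepend ffunE size_mkseq.
    by case: ltnP => kn; [rewrite nth_mkseq | lia].
  rewrite !fE //; last by apply: agreeW xy; rewrite /N; lia.
  apply: cantor_powP => i k; rewrite /prepend ffunE size_mkseq.
  have aN : (a i <= N)%N by have := le_maxfun a i; rewrite /N; lia.
  case: ltnP => kb.
    rewrite nth_mkseq // /splice; case: ltnP => // bk.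
    by rewrite xy //; lia.
  rewrite /splice; case: ltnP => [|bk]; first lia.
  rewrite /y /prepend ffunE size_mkseq; case: ltnP => [|Nk]; first lia.
  by congr (z i _); lia.
exists n => w wn.
have [w' w'P] := nP (prepend w point).
have e : wcat (tr n (prepend w point)) (wdrop (tr n (prepend w point)) w) = w.
  apply: (@wdropK _ _ _ point); first by move=> i; rewrite ffunE size_mkseq.
  exact/trcone.
exists (wcat w' (wdrop (tr n (prepend w point)) w)); split => [i|z].
  by rewrite !ffunE size_cat size_drop size_mkseq; lia.
by rewrite -{1}e !prepend_cat w'P.
Qed.

(** Clopenness as a single depth deciding membership; by compactness, local constancy is enough
    ([clopen_set_local]). *)
Definition clopen_set (A : cantor_pow d -> Prop) :=
  exists n, forall x y, agree n x y -> A x -> A y.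

Lemma clopen_set_local (A : cantor_pow d -> Prop) :
  (forall x, exists n, forall y, agree n x y -> (A x <-> A y)) -> clopen_set A.
Proof.
move=> loc; pose Q n x := forall y, agree n x y -> (A x <-> A y).
have [n x y xy Qx z yz|m n x mn Qx y xy||n nP] := @cantor_pow_uniform d Q.
- by rewrite -(Qx _ xy) (Qx z) //; apply: agree_trans yz.
- by apply/Qx/(agreeW mn).
- exact: loc.
- by exists n => x y xy /(nP x _ xy).
Qed.

Lemma clopen_setP A : clopen_set A -> forall x, exists n, forall y, agree n x y -> (A x <-> A y).
Proof.
move=> [n nP] x; exists n => y xy; split; first exact: nP.
exact/nP/agree_sym.
Qed.

Lemma clopen_set_preim A f : clopen_set A -> (forall x, continuous_at f x) -> clopen_set (fun x => A (f x)).
Proof.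
move=> /clopen_setP cA cf; apply: clopen_set_local => x; have [n nP] := cA (f x).
by have [m mP] := cf x n; exists m => y /mP/nP.
Qed.

Lemma clopen_setC A : clopen_set A -> clopen_set (fun x => ~ A x).
Proof. by move=> /clopen_setP cA; apply: clopen_set_local => x; have [n nP] := cA x; exists n => y /nP ->. Qed.

Lemma clopen_setI A B : clopen_set A -> clopen_set B -> clopen_set (fun x => A x /\ B x).
Proof.
move=> [n nP] [m mP]; exists (maxn n m) => x y xy [Ax Bx].
by split; [apply: nP Ax | apply: mP Bx]; apply: agreeW xy; lia.
Qed.

Lemma clopen_setU A B : clopen_set A -> clopen_set B -> clopen_set (fun x => A x \/ B x).
Proof.
move=> [n nP] [m mP]; exists (maxn n m) => x y xy [Ax|Bx].
  by left; apply: nP Ax; apply: agreeW xy; lia.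
by right; apply: mP Bx; apply: agreeW xy; lia.
Qed.

Lemma clopen_set_agree n x : clopen_set (agree n x).
Proof. by exists n => y z yz xy; apply: agree_trans yz. Qed.

Lemma clopen_set_bit i k (c : bool) : clopen_set (fun x => x i k = c).
Proof. by exists k.+1 => x y xy <-; rewrite xy. Qed.

Lemma move_small f x : continuous_at f x -> f x <> x ->
  exists n, forall y, agree n x y -> ~ agree n x (f y).
Proof.
move=> fc fx; have [m mP] := neq_agree fx; have [n nP] := fc m.
exists (maxn n m) => y xy xfy; apply: mP; apply: agree_sym.
apply: agree_trans (agreeW _ xfy) _; first by lia.
by apply/agree_sym/nP; apply: agreeW xy; lia.
Qed.

End LocalPrefix.

Local Open Scope group_scope.

(** * Rubin's theorem *)

Lemma aut_f1 (G : groupType) (a : aut G) : a 1 = 1.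
Proof. by apply: (mulgI (a 1)); rewrite -gmulfM !mulg1. Qed.

(** * Commutation conditions attached to an involution *)

Section InvolutionCommutants.
Variable G : groupType.
Implicit Types (p f g : G) (S : G -> Prop).

Definition centralizes S g := forall s, S s -> g * s = s * g.
(** Three purely group-theoretic conditions, hence carried along by automorphisms. The local factors
    include the restrictions of [p] to invariant clopen sets; the final [bicommutant p] is the rigid
    stabilizer of [supp p] ([bicommutantE]). *)
Definition local_factors p f :=
  [/\ f * p = p * f, f * f = 1 & forall g, g * p = p * g -> f * f ^ g = f ^ g * f].
Definition factor_squares p g :=
  exists2 f, centralizes (local_factors p) f & g = f * f.
Definition bicommutant p := centralizes (factor_squares p).

Lemma local_factors_aut (a : aut G) p f :
  local_factors p f -> local_factors (a p) (a f).
Proof.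
move=> [fp ff fg]; split; first by rewrite -!gmulfM fp.
  by rewrite -gmulfM ff aut_f1.
move=> g gp; rewrite -[g](autVK a) -aut_conjg -!gmulfM fg //.
by apply: (can_inj (autKV a)); rewrite !gmulfM autVK.
Qed.

Lemma centralizes_aut (a : aut G) S S' g :
  (forall s, S' s -> S ((a^-1 : aut G) s)) ->
  centralizes S g -> centralizes S' (a g).
Proof.
move=> SS Cg s S's; apply: (can_inj (autVK a)).
by rewrite !gmulfM autKV; apply/Cg/SS.
Qed.

Lemma bicommutant_aut (a : aut G) p g : bicommutant p g -> bicommutant (a p) (a g).
Proof.
have K (b : aut G) q s : local_factors (b q) s -> local_factors q ((b^-1 : aut G) s).
  by move/(local_factors_aut b^-1); rewrite autKV.
apply: centralizes_aut => s [f Cf ->].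
exists ((a^-1 : aut G) f); last by rewrite gmulfM.
rewrite -[p](autKV a); apply: centralizes_aut Cf => t.
exact: K.
Qed.

Lemma bicommutant_autE (a : aut G) p g : bicommutant p g <-> bicommutant (a p) (a g).
Proof.
split; first exact: bicommutant_aut.
by move/(@bicommutant_aut a^-1 _ _); rewrite !autKV.
Qed.

End InvolutionCommutants.

(** * Supports and rigid stabilizers in dV *)

Section RigidStabilizers.
Variable d : nat.
Local Notation X := (cantor_pow d.+1).
Implicit Types (x y z : X) (f g p : dV d.+1) (A B : X -> Prop).

Lemma dVM f g x : (f * g) x = g (f x). Proof. by []. Qed.

Lemma dVK f : cancel f (f^-1 : dV _).
Proof. by move=> x; rewrite -dVM mulgV. Qed.

Lemma dVVK f : cancel (f^-1 : dV _) f.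
Proof. by move=> x; rewrite -dVM mulVg. Qed.

Lemma dVJ f g x : (f ^ g) x = g (f ((g^-1 : dV _) x)). Proof. by []. Qed.

Lemma dV_continuous f x : continuous_at f x.
Proof. exact/prefix_at_continuous/dV_prefix_at. Qed.

Definition rist A g := forall x, ~ A x -> g x = x.
Definition supp g x := g x <> x.

Lemma rist_stable A g x : rist A g -> A x -> A (g x).
Proof.
move=> Ag Ax; apply: contrapT => nAgx.
by have /(can_inj (dVK g)) e := Ag _ nAgx; apply: nAgx; rewrite e.
Qed.

Lemma ristV A g : rist A g -> rist A g^-1.
Proof. by move=> Ag x nAx; apply: (can_inj (dVK g)); rewrite dVVK Ag. Qed.

Lemma ristM A f g : rist A f -> rist A g -> rist A (f * g).
Proof. by move=> Af Ag x nAx; rewrite dVM Af // Ag. Qed.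

Lemma ristS A B g : (forall x, A x -> B x) -> rist A g -> rist B g.
Proof. by move=> AB Ag x nBx; apply: Ag => /AB. Qed.

Lemma rist_commute A B f g : (forall x, A x -> ~ B x) ->
  rist A f -> rist B g -> f * g = g * f.
Proof.
move=> dis Af Bg; apply: dV_eq => x; rewrite !dVM.
have [Ax|nAx] := pselect (A x).
  by rewrite (Bg x) ?(Bg (f x)) //; apply: dis => //; apply: rist_stable.
rewrite (Af x) //; have [Bx|nBx] := pselect (B x); last by rewrite !Bg // Af.
by rewrite Af // => /dis; apply; apply: rist_stable.
Qed.

Definition flip n A x : X :=
  fun i k => if `[< A x >] && (i == ord0) && (k == n) then ~~ x i k else x i k.

Lemma flip_dV n A : (forall x y, agree n x y -> A x -> A y) ->
  exists2 g : dV d.+1, g =1 flip n A & g * g = 1.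
Proof.
move=> An.
have aflip x : agree n x (flip n A x).
  by move=> i k kn; rewrite /flip (ltn_eqF kn) andbF.
have AE x y : agree n x y -> `[< A x >] = `[< A y >].
  by move=> xy; apply/asboolP/asboolP; apply: An => //; apply: agree_sym.
have flipK : involutive (flip n A).
  move=> x; apply: cantor_powP => i k; rewrite {1}/flip -(AE x) //.
  by rewrite /flip; case: (_ && _); rewrite ?negbK.
have pf : prefix_exchange_map (flip n A).
  apply: prefix_at_dV; first by exists (flip n A).
  move=> x; exists (fun=> n.+1), (fun=> n.+1), (flip n A x), n.+1 => y xy.
  apply: cantor_powP => i k; rewrite /splice /flip -(AE x y).
    by case: ltnP => kn; [rewrite xy | rewrite subnKC // (gtn_eqF kn) andbF].
  exact: agreeW xy.
by exists (PrefixExchange pf) => //; apply: dV_eq => x; apply: flipK.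
Qed.

Lemma flip_neq n A x : A x -> flip n A x <> x.
Proof.
move=> Ax /(congr1 (fun z : X => z ord0 n)); rewrite /flip !eqxx !andbT.
by case: asboolP => // _; case: (x ord0 n).
Qed.

Lemma flip_id n A x : ~ A x -> flip n A x = x.
Proof. by move=> nAx; apply: cantor_powP => i k; rewrite /flip; case: asboolP. Qed.

Lemma exists_involution A : clopen_set A ->
  exists2 p, p * p = 1 & forall x, A x <-> supp p x.
Proof.
move=> [n /flip_dV[g gE gg]]; exists g => // x; rewrite /supp gE.
split; first exact: flip_neq.
by apply: contra_notP; apply: flip_id.
Qed.

(** Letters [n] and [n.+1] of coordinate 0 do not affect membership in [A]; on them [h * g] is the
    odometer modulo 4, whose square has no fixed point in [A]. *)
Lemma rist_order4 A x : clopen_set A -> A x -> exists2 g, rist A g & g (g x) <> x.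
Proof.
move=> [n An] Ax; pose B y := A y /\ y ord0 n = true.
have [g gE _] := flip_dV An.
have Bn y z : agree n.+1 y z -> B y -> B z.
  by move=> yz [Ay yn]; split; [apply: An Ay; apply: agreeW yz | rewrite -yz].
have [h hE _] := flip_dV Bn.
exists (h * g).
  apply: ristM => y nAy; first by rewrite hE flip_id // => -[].
  by rewrite gE flip_id.
set c := h * g.
have Ac y : A y -> A (c y).
  apply: rist_stable; apply: ristM => z nAz; first by rewrite hE flip_id // => -[].
  by rewrite gE flip_id.
have cn y : A y -> c y ord0 n = ~~ y ord0 n.
  move=> Ay; rewrite dVM gE /flip !eqxx !andbT.
  have Ah : A (h y).
    by apply: rist_stable Ay => z nAz; rewrite hE flip_id // => -[].
  rewrite asboolT // hE /flip.
  by rewrite (ltn_eqF (ltnSn n)) andbF.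
have cn1 y : A y -> c y ord0 n.+1 = y ord0 n (+) y ord0 n.+1.
  move=> Ay; rewrite dVM gE /flip.
  rewrite (gtn_eqF (ltnSn n)) andbF hE /flip !eqxx !andbT.
  have -> : `[< B y >] = y ord0 n by apply/asboolP/idP => [[]|].
  by case: (y ord0 n).
move/(congr1 (fun z : X => z ord0 n.+1)); rewrite cn1 ?cn ?cn1 //; last exact: Ac.
by case: (x ord0 n); case: (x ord0 n.+1).
Qed.

End RigidStabilizers.

(** * Fixed points of prefix exchange germs *)

Section FixedPoints.
Variable d : nat.
Implicit Types (x y e : cantor_pow d) (a b : 'I_d -> nat) (i : 'I_d).

(** A germ that changes the length in coordinate [i] is contracting or expanding there. The
    fixed-point equation gives each letter from an earlier one, read forwards if [a i < b i] and
    backwards if [b i < a i], so an initial segment determines the coordinate. *)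
Lemma splice_fix a b e x y i n : a i <> b i -> (a i <= n)%N -> agree n x y ->
  splice a b e x i = x i -> splice a b e y i = y i -> y i = x i.
Proof.
move=> ab an xy fx fy.
have E (z : cantor_pow d) : splice a b e z i = z i ->
    forall k, z i k = if (k < b i)%N then e i k else z i (a i + (k - b i))%N.
  by move=> fz k; rewrite -{1}fz.
move: fx fy => /E fx /E fy; apply: funext => k; elim/ltn_ind: k => k IH.
have [lt_ab|le_ba] := ltnP (a i) (b i).
  rewrite fx fy; case: ltnP => // bk; apply: IH; lia.
have [ka|ak] := ltnP k (a i); first by rewrite xy //; lia.
have -> : k = (a i + ((b i + (k - a i)) - b i))%N by lia.
have := fx (b i + (k - a i))%N; have := fy (b i + (k - a i))%N.
by rewrite ltnNge leq_addr /= => <- <-; apply: IH; lia.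
Qed.

Lemma splice_eq a b x i n y : a i = b i -> (a i <= n)%N -> agree n x y ->
  splice a b x y i = y i.
Proof.
move=> ab an xy; apply: funext => k; rewrite /splice -ab.
by case: ltnP => ak; [rewrite xy //; lia | rewrite subnKC].
Qed.

Definition upd x i (c : nat -> bool) : cantor_pow d :=
  fun j => if j == i then c else x j.

Lemma updE x i c : upd x i c i = c. Proof. by rewrite /upd eqxx. Qed.

Lemma upd_neq x i c j : j <> i -> upd x i c j = x j.
Proof. by rewrite /upd; case: eqP. Qed.

Lemma agree_upd n x i (c : nat -> bool) :
  (forall k, (k < n)%N -> c k = x i k) -> agree n x (upd x i c).
Proof. by move=> cx j k kn; rewrite /upd; case: eqP => // ->; rewrite cx. Qed.

Lemma exists_agree_neq n x i : exists2 y, agree n x y & y i <> x i.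
Proof.
exists (upd x i (fun k => if (k < n)%N then x i k else ~~ x i k)).
  by apply: agree_upd => k ->.
by rewrite updE => /(congr1 (fun c => c n)); rewrite ltnn; case: (x i n).
Qed.

End FixedPoints.

(** * Recovering rigid stabilizers from commutation *)

Section Reconstruction.
Variable d : nat.
Local Notation X := (cantor_pow d.+1).
Implicit Types (x y z : X) (f g p : dV d.+1) (A B : X -> Prop).

Lemma involutionK p : p * p = 1 -> forall x, p (p x) = x.
Proof. by move=> pp x; rewrite -dVM pp. Qed.

Lemma clopen_set_supp p : p * p = 1 -> clopen_set (supp p).
Proof.
move=> /involutionK pp; apply: clopen_set_local => x.
have [px|px] := pselect (p x = x); last first.
  have [n nP] := move_small (@dV_continuous _ p x) px.
  by exists n => y xy; split => // _ py; apply: (nP _ xy); rewrite py.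
have [a [b [e [n pE]]]] := dV_prefix_at p x.
have [m mP] := @dV_continuous _ p x n; rewrite px in mP.
(* If the lengths differed in coordinate [i], they would differ for the germ of [p * p] as well,
   which fixes every point near [x]; this contradicts [splice_fix]. With equal lengths [p] is
   trivial near [x]. *)
have ab i : a i = b i.
  apply: contrapT => ab.
  have [y xy ne] := exists_agree_neq (maxn (maxn n m) (a i + a i)) x i; apply: ne.
  have ppE z : agree (maxn n m) x z -> z = splice a b e (splice a b e z).
    move=> xz; rewrite -(pE z); last by apply: agreeW xz; lia.
    rewrite -pE ?pp //.
    by apply: mP; apply: agreeW xz; lia.
  have xx := ppE x (@agreexx _ _ _); have yy := ppE y (agreeW (leq_maxl _ _) xy).
  rewrite splice_comp in xx; rewrite splice_comp in yy.
  apply: (splice_fix (n := (a i + a i)%N) _ _ _ (congr1 (@^~ i) (esym xx))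
    (congr1 (@^~ i) (esym yy))); try lia.
  by apply: agreeW xy; lia.
exists (maxn n (\max_i a i)) => y xy; rewrite /supp px.
split => // /(_ _) ne; exfalso; apply: ne; apply: funext => i.
have xE : x = splice a b e x by rewrite -{1}px pE.
rewrite pE; last by apply: agreeW xy; lia.
rewrite -(splice_base a b e x) -xE; apply: (splice_eq (ab i) _ xy).
by have := le_maxfun a i; lia.
Qed.

Lemma exists_displaced A f x : clopen_set A -> A x -> f x <> x ->
  exists U, [/\ clopen_set U, U x, forall y, U y -> A y & forall y, U y -> ~ U (f y)].
Proof.
move=> cA Ax fx; have [n nP] := move_small (@dV_continuous _ f x) fx.
exists (fun y => agree n x y /\ A y); split=> //; first exact/clopen_setI/cA/clopen_set_agree.
  by move=> y [].
by move=> y [/nP nfy _] [].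
Qed.

(** If [f] moves a point [x] outside [supp p], choose [g] supported in a small set [U] off [supp p]
    that [f] displaces. Then [g] commutes with [p], and evaluating [f * f ^ g = f ^ g * f] at [x]
    gives [g (g x) = x], against [rist_order4]. *)
Lemma local_factors_rist p f : p * p = 1 -> local_factors p f -> rist (supp p) f.
Proof.
move=> pp [fp /involutionK ff fg] x /contrapT px; apply: contrapT => fx.
have [U [cU Ux UA Uf]] := exists_displaced (clopen_setC (clopen_set_supp pp)) (fun q => q px) fx.
have [g Ug gg] := rist_order4 cU Ux; apply: gg.
have := fg g (rist_commute (fun y Uy => UA y Uy) Ug (fun y (py : ~ supp p y) => contrapT py)).
move/(congr1 (fun h : dV _ => h x)); rewrite !dVM.
rewrite (ristV Ug); last exact: Uf.
have Ugx : U ((g^-1 : dV _) x) by apply: rist_stable (ristV Ug) Ux.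
by rewrite (Ug (f ((g^-1 : dV _) x))) ?ff; [move->; rewrite dVVK | exact: Uf].
Qed.

Lemma bicommutant_rist p f : p * p = 1 -> bicommutant p f -> rist (supp p) f.
Proof.
move=> pp Wf x /contrapT px; apply: contrapT => fx.
have [U [cU Ux UA Uf]] := exists_displaced (clopen_setC (clopen_set_supp pp)) (fun q => q px) fx.
have [g Ug gg] := rist_order4 cU Ux; apply: gg.
have : f * (g * g) = (g * g) * f.
  apply: Wf; exists g => // h /(local_factors_rist pp) ph.
  by apply: rist_commute Ug ph => y /UA.
move/(congr1 (fun h : dV _ => h x)); rewrite !dVM.
have gfx : g (f x) = f x by apply/Ug/Uf.
by rewrite gfx gfx => /(can_inj (dVK f)).
Qed.

Definition restrict p A x := if `[< A x >] then p x else x.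

Lemma restrict_dV p A : p * p = 1 -> clopen_set A -> (forall x, A x -> A (p x)) ->
  exists q : dV d.+1, q =1 restrict p A.
Proof.
move=> /involutionK pp cA Ap.
have rK : involutive (restrict p A).
  move=> x; rewrite {2}/restrict; case: asboolP => Ax; rewrite /restrict.
    by rewrite asboolT ?pp //; apply: Ap.
  by rewrite asboolF.
suff pf : prefix_exchange_map (restrict p A) by exists (PrefixExchange pf).
apply: prefix_at_dV => [|x]; first by exists (restrict p A).
have [n nA] := clopen_setP cA x.
have [Ax|nAx] := pselect (A x).
  apply: (@prefix_at_near _ p _ _ n) (dV_prefix_at p x) => y /nA Ay.
  by rewrite /restrict asboolT // -Ay.
apply: (@prefix_at_near _ id _ _ n) (prefix_at_id x) => y /nA Ay.
by rewrite /restrict asboolF // -Ay.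
Qed.

Lemma restrict_local_factor p A (q : dV d.+1) : p * p = 1 -> (forall x, A x -> A (p x)) ->
  q =1 restrict p A -> local_factors p q.
Proof.
move=> /involutionK pp Ap qE.
have ApE x : A (p x) <-> A x by split=> [/Ap|/Ap //]; rewrite pp.
have ApB x : `[< A (p x) >] = `[< A x >] by apply/asboolP/asboolP => /ApE.
split.
- apply: dV_eq => x; rewrite !dVM !qE /restrict ApB.
  by case: ifP.
- apply: dV_eq => x; rewrite dVM !qE /restrict.
  by case: (boolP `[< A x >]) => Ax; rewrite ?ApB ?Ax ?pp // (negbTE Ax).
move=> g gp; have gpE x : g (p x) = p (g x) by rewrite -!dVM gp.
have gVpE x : (g^-1 : dV _) (p x) = p ((g^-1 : dV _) x).
  by apply: (can_inj (dVK g)); rewrite gpE !dVVK.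
have qJ x : (q ^ g) x = if `[< A ((g^-1 : dV _) x) >] then p x else x.
  by rewrite dVJ qE /restrict; case: ifP => _; rewrite ?gpE dVVK.
apply: dV_eq => x; change ((q ^ g) (q x) = q ((q ^ g) x)).
rewrite !qJ !qE /restrict.
case: (boolP `[< A x >]) => Ax; case: (boolP `[< A ((g^-1 : dV _) x) >]) => Agx;
  by rewrite ?gVpE ?ApB ?Ax ?(negbTE Ax) ?Agx ?(negbTE Agx).
Qed.

(* A square of an element commuting with the restrictions of p to small       *)
(* p-invariant clopen sets is trivial on supp p, as that element preserves     *)
(* every orbit {x, p x} there.                                                *)
Lemma rist_bicommutant p f : p * p = 1 -> rist (supp p) f -> bicommutant p f.
Proof.
move=> pp Af s [v Cv ->]; apply: (rist_commute (B := fun x => ~ supp p x)) Af _.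
  by move=> x px; apply.
move=> x /contrapT px; have pK := involutionK pp.
have orbit y : supp p y -> v y = y \/ v y = p y.
  move=> py; apply: contrapT => /not_orP[vy vpy].
  have [n nP] := neq_agree (nesym vy).
  have [m mP] : exists m, ~ agree m y (p (v y)).
    by apply: neq_agree => e; apply: vpy; rewrite {2}e pK.
  (* A [p]-invariant clopen neighbourhood of the orbit of [y], small enough to miss [v y]. *)
  pose A z := agree (maxn n m) y z \/ agree (maxn n m) y (p z).
  have cA : clopen_set A.
    by apply/clopen_setU/(clopen_set_preim (clopen_set_agree _ _) (@dV_continuous _ p))/clopen_set_agree.
  have Ap z : A z -> A (p z) by case=> yz; [right; rewrite pK | left].
  have [q qE] := restrict_dV pp cA Ap.
  have := Cv q (restrict_local_factor pp Ap qE).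
  move/(congr1 (fun h : dV _ => h y)); rewrite !dVM !qE /restrict.
  have Ay : A y by left.
  have nAv : ~ A (v y).
    by case=> yv; [apply: nP | apply: mP]; apply: agreeW yv; lia.
  by rewrite (asboolT Ay) (asboolF nAv) => /(can_inj (dVK v))/esym.
rewrite dVM; case: (orbit x px) => vx; rewrite vx //.
have ppx : supp p (p x) by rewrite /supp pK => /esym.
case: (orbit _ ppx) => [|->]; last exact: pK.
by move=> e; case: px; apply: (can_inj (dVK v)); rewrite e vx.
Qed.

End Reconstruction.

(** * From automorphisms to homeomorphisms *)

Section Rubin.
Variable d : nat.
Local Notation X := (cantor_pow d.+1).
Implicit Types (x y z : X) (f g p : dV d.+1) (A B : X -> Prop).
Implicit Types (a b : aut (dV d.+1)).

Lemma bicommutantE p f : p * p = 1 -> bicommutant p f <-> rist (supp p) f.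
Proof. by move=> pp; split; [apply: bicommutant_rist | apply: rist_bicommutant]. Qed.

(** For clopen [A] this is the image of [A] under the homeomorphism to be constructed, expressed
    through the group alone as a union of supports. *)
Definition transport a A y := exists2 g, rist A g & supp (a g) y.

(** Take an involution [p] with support [A]: the rigid stabilizer of [A] is [bicommutant p], which
    [a] carries to [bicommutant (a p)], so the transported set is [supp (a p)]. *)
Lemma transport_rist a A : clopen_set A ->
  clopen_set (transport a A) /\ forall g, rist A g <-> rist (transport a A) (a g).
Proof.
move=> /exists_involution[p pp Ap].
have app : a p * a p = 1 by rewrite -gmulfM pp aut_f1.
have AE : A = supp p by apply: funext => x; apply/propext/Ap.
have ristE g : rist A g <-> rist (supp (a p)) (a g).
  by rewrite AE -bicommutantE // -bicommutantE // -bicommutant_autE.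
suff -> : transport a A = supp (a p) by split; [apply: clopen_set_supp|].
apply: funext => y; apply/propext; split.
  by case=> g /ristE ag gy; apply: contrapT => /ag.
by move=> apy; exists p => // x; rewrite AE => /contrapT.
Qed.

Lemma clopen_transport a A : clopen_set A -> clopen_set (transport a A).
Proof. by case/(transport_rist a). Qed.

Lemma transportS a A B : (forall x, A x -> B x) ->
  forall y, transport a A y -> transport a B y.
Proof. by move=> AB y [g Ag gy]; exists g => //; apply: ristS Ag. Qed.

Lemma transportK a b A y : cancel a b -> clopen_set A ->
  transport b (transport a A) y <-> A y.
Proof.
move=> aK cA; have [_ ristE] := transport_rist a cA.
have bK : cancel b a by move=> g; have [c cK1 cK2] := aut_bij a; rewrite -(cK2 g) aK.
split=> [[g ag gy]|Ay].
  apply: contrapT => nAy; apply: gy; move: ag; rewrite -[g]bK.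
  by move/ristE => Ag; rewrite aK; apply: Ag.
have [p pp Ap] := exists_involution cA; exists (a p); last by rewrite aK; apply/Ap.
by apply/ristE => x; rewrite Ap => /contrapT.
Qed.

Lemma transportI a b A B y : cancel a b -> cancel b a -> clopen_set A -> clopen_set B ->
  transport a A y -> transport a B y -> transport a (fun x => A x /\ B x) y.
Proof.
move=> aK bK cA cB Ay By.
have cAB := clopen_setI (clopen_transport a cA) (clopen_transport a cB).
have /(transportK _ bK cAB) := conj Ay By.
apply: transportS => x abx; split.
  by apply/(transportK x aK cA); apply: transportS abx => z [].
by apply/(transportK x aK cB); apply: transportS abx => z [].
Qed.

Lemma transportC a b A y : cancel a b -> cancel b a -> clopen_set A ->
  transport a (fun x => ~ A x) y <-> ~ transport a A y.
Proof.
move=> aK bK cA; have cA' := clopen_setC cA; split=> [A'y Ay|].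
  have [g ag gy] := transportI aK bK cA cA' Ay A'y; apply: gy.
  have -> : g = 1 by apply: dV_eq => x; apply: ag => -[].
  by rewrite aut_f1.
apply: contra_notP => nA'y; have cAA := clopen_setU (clopen_transport a cA) (clopen_transport a cA').
have cT : clopen_set (fun _ : X => True) by exists 0%N.
suff : transport a A y \/ transport a (fun x => ~ A x) y by case.
apply/(transportK y bK cAA).
apply: (@transportS _ (transport b (fun=> True))); last exact/(transportK y bK cT).
move=> x _; have [Ax|nAx] := pselect (A x).
  by move/(transportK x aK cA): Ax; apply: transportS; left.
by move/(transportK x aK cA'): nAx; apply: transportS; right.
Qed.

Lemma transport_equivariant a f A y :
  transport a (fun x => A (f x)) y <-> transport a A (a f y).
Proof.
have suppE g : supp (a (g ^ f)) (a f y) <-> supp (a g) y.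
  rewrite aut_conjg /supp dVJ dVK; split=> ne e; apply: ne; first by rewrite e.
  exact: (can_inj (dVK _) e).
split=> -[g Ag gy].
  by exists (g ^ f); [move=> x nAx; rewrite dVJ Ag ?dVVK | apply/suppE].
exists (g ^ f^-1); last by apply/suppE; rewrite conjgKV.
by move=> x nAx; rewrite dVJ invgK Ag ?dVK.
Qed.

(* The complement, meet and membership laws of [transport] make this the point *)
(* of the ultrafilter {A | x \in transport a^-1 A} of clopen sets.             *)
Definition point_map a x : X := fun i k => `[< transport a^-1 (fun y => y i k = true) x >].

Lemma point_mapE a A x : clopen_set A -> A (point_map a x) <-> transport a^-1 A x.
Proof.
have aK : cancel (a^-1 : aut _) a by exact: autVK.
have aVK : cancel a (a^-1 : aut _) by exact: autKV.
have bit i k : transport a^-1 (fun y => y i k = point_map a x i k) x.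
  rewrite /point_map; case: asboolP => // nb.
  move/(transportC x aK aVK (clopen_set_bit i k true)): nb; apply: transportS => y.
  by case: (y i k).
have cube n : transport a^-1 (agree n (point_map a x)) x.
  pose s := [seq (i, k) | i <- enum 'I_d.+1, k <- iota 0 n].
  pose P s y := all (fun p : 'I_d.+1 * nat => y p.1 p.2 == point_map a x p.1 p.2) s.
  have cP t : clopen_set (P t).
    elim: t => [|p t IH]; first by exists 0%N.
    apply: clopen_set_local => y.
    have [n1 n1P] := clopen_setP (clopen_set_bit p.1 p.2 (point_map a x p.1 p.2)) y.
    have [n2 n2P] := clopen_setP IH y.
    exists (maxn n1 n2) => z yz; rewrite /P /=.
    have e1 := n1P z (agreeW (leq_maxl _ _) yz).
    have e2 := n2P z (agreeW (leq_maxr _ _) yz).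
    by split=> /andP[/eqP p1 p2]; apply/andP; split; [apply/eqP/e1|apply/e2|apply/eqP/e1|apply/e2].
  have : transport a^-1 (P s) x.
    elim: (s) => [|p t IH]; last first.
      have := transportI aK aVK (clopen_set_bit p.1 p.2 (point_map a x p.1 p.2)) (cP t) (bit _ _) IH.
      by apply: transportS => y [/eqP yp yt]; apply/andP.
    have cT : clopen_set (fun _ : X => True) by exists 0%N.
    apply: (@transportS _ (transport a (fun=> True))) => //.
    exact/(transportK x aVK cT).
  apply: transportS => y /allP yP i k kn; apply/esym/eqP/(yP (i, k)).
  by apply/allpairsP; exists (i, k); split=> //; rewrite ?mem_enum // mem_iota.
have imp B : clopen_set B -> B (point_map a x) -> transport a^-1 B x.
  by move=> [n nB] Bx; apply: transportS (cube n) => y /nB; apply.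
move=> cA; split; first exact: imp.
move=> Ax; apply: contrapT => nA.
by have /(transportC x aK aVK cA) := imp _ (clopen_setC cA) nA.
Qed.

Lemma point_map_continuous a x : continuous_at (point_map a) x.
Proof.
move=> n; have cn := clopen_set_agree n (point_map a x).
have [m mP] := clopen_transport a^-1 cn.
exists m => y xy; apply/(point_mapE _ _ cn); apply: mP xy _.
by apply/point_mapE => //; exact: clopen_set_agree.
Qed.

Lemma point_mapK a b : cancel a b -> cancel b a -> cancel (point_map a) (point_map b).
Proof.
move=> aK bK x; apply: cantor_powP => i k.
have eb : b = a^-1 by apply: aut_eq => f; rewrite -[in LHS](autVK a f) aK.
have cb := clopen_set_bit i k true; rewrite eb.
apply/idP/idP => [/(point_mapE a^-1 _ cb)|xik].
  rewrite invgK => /(point_mapE a x (clopen_transport a cb)).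
  by move/(transportK x (autKV a) cb).
apply/(point_mapE a^-1 _ cb); rewrite invgK.
apply/(point_mapE a x (clopen_transport a cb)).
exact/(transportK x (autKV a) cb).
Qed.

Lemma aut_spatial a : exists h h' : X -> X,
  [/\ cancel h h', cancel h' h, forall x, continuous_at h x,
      forall x, continuous_at h' x & forall f x, a f (h x) = h (f x)].
Proof.
exists (point_map a), (point_map a^-1); split.
- exact/point_mapK/autVK/autKV.
- exact/point_mapK/autKV/autVK.
- exact: point_map_continuous.
- exact: point_map_continuous.
move=> f x; apply: cantor_powP => i k.
have cb := clopen_set_bit i k true.
have cb' := clopen_set_preim cb (@dV_continuous _ (a f)).
suff : a f (point_map a x) i k = true <-> point_map a (f x) i k = true.
  by case=> h1 h2; apply/idP/idP.
have := transport_equivariant a^-1 (a f) (fun y => y i k = true) x; rewrite autKV => E.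
exact: iff_trans (point_mapE a x cb') (iff_trans E (iff_sym (point_mapE a (f x) cb))).
Qed.

End Rubin.

(** * Local product structure *)

Section Extension.
Variable d : nat.
Implicit Types (x y z : cantor_pow d) (a b : 'I_d -> nat).

(** The depth is counted relative to [a], so that [splice a b y] carries the box of [x] onto the box
    of [y] with the same [N] whenever the tails match ([splice_box]). *)
Definition box N a x z := forall i k, (k < a i + N)%N -> z i k = x i k.

Lemma clopen_set_box N a x : clopen_set (box N a x).
Proof.
exists (\max_i a i + N)%N => y z yz xy i k ka.
by rewrite -xy // yz //; have := le_maxfun a i; lia.
Qed.

Lemma splice_box N a b x y z : (forall i k, y i (b i + k)%N = x i (a i + k)%N) ->
  box N a x z -> box N b y (splice a b y z) /\ splice b a x (splice a b y z) = z.
Proof.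
move=> yx xz; split=> [i k kb|].
  rewrite /splice; case: ltnP => // bk.
  by rewrite xz; [rewrite -yx subnKC | lia].
apply: cantor_powP => i k; rewrite /splice.
case: ltnP => ak; first by rewrite xz //; lia.
by rewrite ltnNge leq_addr /= addKn subnKC.
Qed.

Lemma swap_boxes N a b x y : (forall i k, y i (b i + k)%N = x i (a i + k)%N) ->
  (forall z, box N a x z -> ~ box N b y z) ->
  exists g : dV d, forall z, box N a x z -> g z = splice a b y z.
Proof.
move=> yx dis; have xy i k : x i (a i + k)%N = y i (b i + k)%N by rewrite yx.
pose s z := if `[< box N a x z >] then splice a b y z
            else if `[< box N b y z >] then splice b a x z else z.
have sK : involutive s.
  move=> z; rewrite {2}/s; case: asboolP => [xz|nxz].
    have [yz zK] := splice_box yx xz.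
    by rewrite /s asboolF ?asboolT // => /dis.
  case: asboolP => [yz|nyz]; last by rewrite /s !asboolF.
  by have [xz zK] := splice_box xy yz; rewrite /s asboolT.
suff pf : prefix_exchange_map s.
  by exists (PrefixExchange pf) => z xz /=; rewrite /s asboolT.
apply: prefix_at_dV => [|z]; first by exists s.
have [n1 n1P] := clopen_setP (clopen_set_box N a x) z; have [n2 n2P] := clopen_setP (clopen_set_box N b y) z.
have sE w : agree (maxn n1 n2) z w -> s w = if `[< box N a x z >] then splice a b y w
            else if `[< box N b y z >] then splice b a x w else w.
  move=> zw; rewrite /s -(propext (n1P w (agreeW (leq_maxl _ _) zw))).
  by rewrite -(propext (n2P w (agreeW (leq_maxr _ _) zw))).
apply: prefix_at_near sE _; case: asboolP => _; first exact: prefix_at_splice.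
case: asboolP => _; [exact: prefix_at_splice | exact: prefix_at_id].
Qed.

Lemma agree_box N a x y : agree (\max_i a i + N) x y -> box N a x y.
Proof. by move=> xy i k ka; rewrite xy //; have := le_maxfun a i; lia. Qed.

End Extension.

Section LocalForm.
Variable d : nat.
Local Notation X := (cantor_pow d.+1).
Implicit Types (x y z : X) (a b : 'I_d.+1 -> nat).

Lemma splice_extend_neq a b x y : x <> y ->
  (forall i k, y i (b i + k)%N = x i (a i + k)%N) ->
  exists (g : dV d.+1) n, forall z, agree n x z -> g z = splice a b y z.
Proof.
move=> /neq_agree[N Nxy] yx; have [z xz yz|g gE] := @swap_boxes _ N a b x y yx.
  by apply: Nxy => i k kN; rewrite -xz ?yz //; lia.
by exists g, (\max_i a i + N)%N => z xz; apply/gE/agree_box.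
Qed.

Lemma splice_extend a b x y : (forall i k, y i (b i + k)%N = x i (a i + k)%N) ->
  exists (g : dV d.+1) n, forall z, agree n x z -> g z = splice a b y z.
Proof.
move=> yx; have [xy|] := pselect (x = y); last by move/splice_extend_neq; apply.
(* For [x = y] there are no disjoint boxes to swap. The flip moves [x] off [y], and lengths grow by
   one so that the flipped letter is among the deleted ones; the extra letter written agrees with
   the one erased because the tails match. *)
have [f fE _] : exists2 f : dV d.+1, f =1 flip 0 (fun=> True) & f * f = 1.
  exact: flip_dV.
have fx : f x <> y by rewrite fE -xy; apply: flip_neq.
have fS z i k : f z i k.+1 = z i k.+1 by rewrite fE /flip andbF.
have [i k|g [n gE]] := @splice_extend_neq (fun i => (a i).+1) (fun i => (b i).+1) _ _ fx.
  by rewrite !addSn fS -!addnS.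
have [m mP] := @dV_continuous _ f x n.
exists (f * g), (maxn m (\max_i a i).+1) => z xz.
rewrite dVM gE; last by apply: mP; apply: agreeW xz; lia.
apply: cantor_powP => i k; rewrite /splice addSn fS ltnS.
case: (ltngtP k (b i)) => kb //; first by congr (z i _); lia.
have ak : (a i < maxn m (\max_i a i).+1)%N by have := le_maxfun a i; lia.
by rewrite kb subnn addn0 -xz // -[in LHS](addn0 (b i)) yx addn0.
Qed.

End LocalForm.

Definition zeros d : cantor_pow d := fun _ _ => false.

Section LocalProduct.
Variable d : nat.
Local Notation X := (cantor_pow d.+1).
Local Notation zeros := (@zeros d.+1).
Variables (a : aut (dV d.+1)) (h h' : X -> X).
Hypotheses (hK : cancel h h') (h'K : cancel h' h).
Hypotheses (hc : forall x, continuous_at h x) (h'c : forall x, continuous_at h' x).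
Hypothesis (ha : forall f x, a f (h x) = h (f x)).

(** Near [zeros], prepend one 0 to every coordinate except [i]: the [i]-th axis is fixed pointwise,
    and iterates push nearby points towards it. *)
Definition contracts i (g : dV d.+1) n := forall z, agree n zeros z ->
  g z = splice (fun=> 0%N) (fun k => (k != i) : nat) zeros z.

Lemma exists_contracts i : exists (g : dV d.+1) n, contracts i g n.
Proof. exact: splice_extend. Qed.

Lemma contracts_zeros i g n : contracts i g n -> g zeros = zeros.
Proof.
move=> ->; last by [].
by apply: cantor_powP => k m; rewrite /splice if_same.
Qed.

Lemma contracts_axis i g n c : contracts i g n -> agree n zeros (upd zeros i c) ->
  g (upd zeros i c) = upd zeros i c.
Proof.
move=> gn nc; rewrite gn //; apply: cantor_powP => k m; rewrite /splice add0n /upd.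
by case: eqP => /= _; [rewrite subn0 | rewrite if_same].
Qed.

(* If every conjugate a g_i were nontrivial in coordinate j near h zeros, then *)
(* the part of one of them in coordinate j alone would pull back along h to a  *)
(* germ at zeros fixing every axis pointwise, hence to a trivial germ.         *)
Lemma exists_trivial_coordinate j : exists i,
  forall g n, contracts i g n -> exists m, forall y, agree m (h zeros) y -> a g y j = y j.
Proof.
apply: contrapT => /forallNP no; set q := h zeros.
have nontriv i : exists g n, contracts i g n /\ exists a1 b1 e m, a1 j <> b1 j /\
    forall y, agree m q y -> a g y = splice a1 b1 e y.
  have := no i; move=> /existsNP[g /existsNP[n /not_implyP[gn /forallNP nt]]].
  exists g, n; split => //.
  have [a1 [b1 [e [m agE]]]] := dV_prefix_at (a g) q; exists a1, b1, e, m; split => // ab.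
  apply: (nt (maxn m (\max_i a1 i))) => y qy.
  have qE : q = splice a1 b1 e q by rewrite -agE // ha (contracts_zeros gn).
  rewrite agE; last by apply: agreeW qy; lia.
  rewrite -(splice_base a1 b1 e q) -qE; apply: (splice_eq ab _ qy).
  by have := le_maxfun a1 j; lia.
have fixj i : exists (g : dV d.+1) n m, contracts i g n /\
    forall y, agree m q y -> a g y = y -> y j = q j.
  have [g [n [gn [a1 [b1 [e [m [ab agE]]]]]]]] := nontriv i.
  exists g, n, (maxn m (\max_i a1 i)); split => // y qy gy.
  apply: (splice_fix (a := a1) (b := b1) (e := e) (n := \max_i a1 i)%N ab).
  - exact: le_maxfun.
  - by apply: agreeW qy; lia.
  - by rewrite -agE // ha (contracts_zeros gn).
  - by rewrite -agE ?gy //; apply: agreeW qy; lia.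
have [g0 [n0 [g0n [a0 [b0 [e0 [m0 [ab0 ag0E]]]]]]]] := nontriv ord0.
have qE : q = splice a0 b0 e0 q by rewrite -ag0E // ha (contracts_zeros g0n).
(* [R] keeps coordinate [j] of the germ of [a g0] at [q] and is the identity in the others; [S] is
   its preimage under [a]. *)
pose a1 i := if i == j then a0 i else 0%N; pose b1 i := if i == j then b0 i else 0%N.
have [i k|R [n RE]] := @splice_extend d a1 b1 q q.
  rewrite /a1 /b1; case: eqP => // ->.
  by rewrite {1}qE /splice ltnNge leq_addr /= addKn.
have Rfix y : agree n q y -> y j = q j -> R y = y.
  move=> qy yj; rewrite RE //; apply: cantor_powP => i k; rewrite /splice /a1 /b1.
  case: (eqVneq i j) => [->|_]; last by rewrite add0n subn0.
  have := congr1 (fun z : X => z j k) qE; rewrite /splice yj.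
  by case: ltnP.
have Rq : R q = q by apply: Rfix.
have [S SE] : exists S, a S = R by exists ((a^-1 : aut _) R); rewrite autVK.
have hS x : h (S x) = R (h x) by rewrite -SE ha.
have hI := can_inj hK.
have S0 : S zeros = zeros by apply: hI; rewrite hS.
have [aS [bS [eS [nS SEE]]]] := dV_prefix_at S zeros.
have abS i : aS i = bS i.
  apply: contrapT => ab.
  have [g [ng [m [gn gfix]]]] := fixj i.
  have [l lP] := hc zeros (maxn m n).
  have [y zy yi] := exists_agree_neq (maxn (maxn ng nS) (maxn l (aS i))) zeros i.
  have zx : agree (maxn (maxn ng nS) (maxn l (aS i))) zeros (upd zeros i (y i)).
    by apply: agree_upd => k kn; rewrite zy.
  set x := upd _ _ _ in zx.
  have gx : g x = x by apply: (contracts_axis gn); apply: agreeW zx; lia.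
  have qhx : agree (maxn m n) q (h x) by apply: lP; apply: agreeW zx; lia.
  have hxj : h x j = q j by apply: gfix; [apply: agreeW qhx; lia | rewrite ha gx].
  have Sx : S x = x by apply: hI; rewrite hS Rfix //; apply: agreeW qhx; lia.
  apply: yi; rewrite -(updE zeros i (y i)).
  apply: (splice_fix (a := aS) (b := bS) (e := eS) (n := aS i) ab) => //.
  - by apply: agreeW zx; lia.
  - by rewrite -SEE ?S0 //.
  - by rewrite -SEE -/x ?Sx //; apply: agreeW zx; lia.
have zE : zeros = splice aS bS eS zeros by rewrite -SEE.
have Sid x : agree (maxn nS (\max_i aS i)) zeros x -> S x = x.
  move=> zx; rewrite SEE; last by apply: agreeW zx; lia.
  rewrite -(splice_base aS bS eS zeros) -zE; apply: funext => i.
  by apply: (splice_eq (abS i) _ zx); have := le_maxfun aS i; lia.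
(* Since [S] is trivial near [zeros], [R] is trivial near [q] although it changes the length in
   coordinate [j]; a point near [q] with another [j]-th coordinate contradicts [splice_fix]. *)
have [l lP] := h'c q (maxn nS (\max_i aS i)).
have [y qy yj] := exists_agree_neq (maxn (maxn n l) (a0 j)) q j; apply: yj.
have a1j : a1 j = a0 j by rewrite /a1 eqxx.
have b1j : b1 j = b0 j by rewrite /b1 eqxx.
apply: (splice_fix (a := a1) (b := b1) (e := q) (n := a0 j)) => //; rewrite ?a1j ?b1j //.
- by apply: agreeW qy; lia.
- by rewrite -RE // Rq.
- rewrite -RE; last by apply: agreeW qy; lia.
  rewrite -[y]h'K -hS Sid // -[zeros]hK -/q; apply: lP; apply: agreeW qy; lia.
Qed.

(** The iterates of the contraction [g] for [t j] keep [x] near [zeros] and tend to its projection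
    on axis [t j], while [a g] leaves coordinate [j] unchanged near [h zeros]. So [h x j] is
    constant along the iterates, and continuity passes to the limit. *)
Lemma local_product : exists N (t : 'I_d.+1 -> 'I_d.+1), forall x, agree N zeros x ->
  forall j, h x j = h (upd zeros (t j) (x (t j))) j.
Proof.
have [t tP] := choice exists_trivial_coordinate; set q := h zeros in tP.
suff /choice[N NP] : forall j, exists N, forall x, agree N zeros x ->
    h x j = h (upd zeros (t j) (x (t j))) j.
  exists (\max_j N j), t => x zx j; apply: NP; apply: agreeW zx; exact: le_maxfun.
move=> j; have [g [n gn]] := exists_contracts (t j).
have [m mP] := tP j g n gn.
have [l lP] := hc zeros m.
exists (maxn n l) => x zx.
have gE z : agree n zeros z -> forall k r, g z k r =
    if k == t j then z k r else if r is r'.+1 then z k r' else false.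
  move=> zz k r; rewrite gn // /splice add0n; case: eqP => _ /=; first by rewrite subn0.
  by case: r => //= r; rewrite subn1.
have iterP s : agree (maxn n l) zeros (iter s g x) /\ agree s (upd zeros (t j) (x (t j))) (iter s g x)
   /\ iter s g x (t j) = x (t j).
  elim: s => //= s [zs [xs js]]; have gs := gE _ (agreeW (leq_maxl _ _) zs); split; [|split].
  - move=> k r rn; rewrite gs; case: eqP => _; first exact: zs.
    by case: r rn => // r rn; apply: (zs k r); lia.
  - move=> k r rs; rewrite gs; case: eqP => [->|ne]; first by rewrite updE js.
    by rewrite upd_neq //; case: r rs => // r rs; rewrite -xs ?upd_neq //; lia.
  - by apply: funext => r; rewrite gs eqxx js.
have hiter s : h (iter s g x) j = h x j.
  elim: s => //= s <-; rewrite -ha mP //; apply: lP.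
  by apply: agreeW (iterP s).1; lia.
apply: funext => k; have [M MP] := hc (upd zeros (t j) (x (t j))) k.+1.
by rewrite (MP (iter M g x)) ?hiter //; have [_ []] := iterP M.
Qed.

End LocalProduct.

(** * One-variable germs and the product form of an automorphism *)

Definition prefix1_at (f : (nat -> bool) -> nat -> bool) (c : nat -> bool) :=
  exists a b e n, forall c', (forall k, (k < n)%N -> c k = c' k) ->
    f c' = fun k => if (k < b)%N then e k else c' (a + (k - b))%N.

Lemma prefix1_at_id c : prefix1_at id c.
Proof.
exists 0%N, 0%N, c, 0%N => c' _; apply: funext => k.
by rewrite add0n subn0.
Qed.

Lemma prefix_at_coordinate d (F : cantor_pow d -> cantor_pow d) x i f :
  (forall c, F (upd x i c) i = f c) -> prefix_at F x -> prefix1_at f (x i).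
Proof.
move=> Ff [a [b [e [n FE]]]]; exists (a i), (b i), (e i), n => c xc.
rewrite -Ff FE; last by apply: agree_upd => k kn; rewrite xc.
by apply: funext => k; rewrite /splice /upd eqxx.
Qed.

Lemma prefix_at_prod d (fs : 'I_d -> (nat -> bool) -> nat -> bool) (x : cantor_pow d) :
  (forall i, prefix1_at (fs i) (x i)) -> prefix_at (fun y i => fs i (y i)) x.
Proof.
move=> /choice[a /choice[b /choice[e /choice[n fE]]]].
exists a, b, e, (\max_i n i)%N => y xy; apply: funext => i; apply: fE => k kn.
by apply: xy; have := le_maxfun n i; lia.
Qed.

Definition scons (b : bool) (c : nat -> bool) : nat -> bool :=
  fun k => if k is k'.+1 then c k' else b.

Lemma scons_eta c : scons (c 0%N) (fun k => c k.+1) = c.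
Proof. by apply: funext => -[]. Qed.

Lemma scons_inj b c c' : scons b c = scons b c' -> c = c'.
Proof. by move=> e; apply: funext => k; have := congr1 (fun f => f k.+1) e. Qed.

Lemma prefix1_at_scons b f c : prefix1_at f c -> prefix1_at (fun c' => scons b (f c')) c.
Proof.
move=> [a1 [b1 [e [n fE]]]]; exists a1, b1.+1, (scons b e), n => c' cc'.
by rewrite fE //; apply: funext => -[].
Qed.

Lemma prefix1_at_split (f : bool -> (nat -> bool) -> nat -> bool) (c : nat -> bool) :
  prefix1_at (f (c 0%N)) (fun k => c k.+1) ->
  prefix1_at (fun c' => scons (c' 0%N) (f (c' 0%N) (fun k => c' k.+1))) c.
Proof.
move=> [a1 [b1 [e [n fE]]]]; exists a1.+1, b1.+1, (scons (c 0%N) e), n.+1 => c' cc'.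
rewrite -(cc' 0%N) // fE; last by move=> k kn; apply: cc'.
by apply: funext => -[|k] //=; rewrite ltnS subSS addSn.
Qed.

(** A nonempty clopen set is a copy of Cantor space through local prefix exchanges. Induct on the
    depth by splitting on the first letter: if both halves are nonempty, each half of the source
    parametrizes one of them. *)
Lemma clopen_parametrization n (A : (nat -> bool) -> Prop) :
  (forall c c', (forall k, (k < n)%N -> c k = c' k) -> A c -> A c') ->
  (exists c, A c) ->
  exists r, [/\ injective r, forall c, A c <-> exists e, c = r e & forall c, prefix1_at r c].
Proof.
elim: n A => [|n IH] A nA [c0 Ac0].
  exists id; split=> // [c|]; last exact: prefix1_at_id.
  by split=> _; [exists c | apply: nA Ac0].
have nAb b c c' : (forall k, (k < n)%N -> c k = c' k) -> A (scons b c) -> A (scons b c').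
  by move=> cc'; apply: nA => -[|k] //=; rewrite ltnS; apply: cc'.
have cover c : A c <-> A (scons (c 0%N) (fun k => c k.+1)) by rewrite scons_eta.
have one b : (exists c, A (scons b c)) -> (forall c, ~ A (scons (~~ b) c)) ->
    exists r, [/\ injective r, forall c, A c <-> exists e, c = r e & forall c, prefix1_at r c].
  move=> /(IH _ (nAb b))[r [rI rE rl]] no; exists (fun c => scons b (r c)); split.
  - by move=> c c' /scons_inj/rI.
  - move=> c; split=> [/cover|[e ->]]; last by apply/rE; exists e.
    case: (eqVneq (c 0%N) b) => [e0|ne]; last first.
      have -> : c 0%N = ~~ b by case: (c 0%N) ne; case: (b).
      by move/no.
    by rewrite e0 => /rE[e ee]; exists e; rewrite -ee -e0 scons_eta.
  - by move=> c; apply: prefix1_at_scons.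
have [Af|nAf] := pselect (exists c, A (scons false c)); last first.
  apply: (one true); last by move/forallNP: nAf.
  exists (fun k => c0 k.+1); have := Ac0; rewrite {1}cover.
  by case: (c0 0%N) => // Af; case: nAf; eexists; apply: Af.
have [At|nAt] := pselect (exists c, A (scons true c)); last first.
  by apply: (one false) => //; move/forallNP: nAt.
have /choice[r rP] : forall b, exists r, [/\ injective r,
    forall c, A (scons b c) <-> exists e, c = r e & forall c, prefix1_at r c].
  by case; apply: IH => //; apply: nAb.
exists (fun c => scons (c 0%N) (r (c 0%N) (fun k => c k.+1))); split.
- move=> c c' e; have e0 := congr1 (fun f => f 0%N) e; rewrite /= in e0.
  rewrite e0 in e; have [rI _ _] := rP (c' 0%N).
  by move/scons_inj/rI: e => e; rewrite -[c]scons_eta e e0 scons_eta.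
- move=> c; split=> [/cover|[e ->]]; last first.
    by have [_ rE _] := rP (e 0%N); apply/rE; eexists.
  have [_ rE _] := rP (c 0%N) => /rE[e ee]; exists (scons (c 0%N) e).
  by rewrite /= -ee scons_eta.
- by move=> c; apply: prefix1_at_split; have [] := rP (c 0%N).
Qed.

Lemma inj_surj_bijective (T U : Type) (f : T -> U) :
  injective f -> (forall u, exists t, f t = u) -> bijective f.
Proof. by move=> fI /choice[g gK]; exists g => // t; apply: fI; rewrite gK. Qed.

Definition permprod d (k : 'I_d -> (nat -> bool) -> nat -> bool) (s : 'S_d)
    (x : cantor_pow d) : cantor_pow d := fun j => k (s^-1 j) (x (s^-1 j)).

Lemma permprodE d (k : 'I_d -> (nat -> bool) -> nat -> bool) (s : 'S_d) x i :
  permprod k s x (s i) = k i (x i).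
Proof. by rewrite /permprod permK. Qed.

Lemma permprod_bij d (k : 'I_d -> (nat -> bool) -> nat -> bool) (s : 'S_d) :
  (forall i, bijective (k i)) -> bijective (permprod k s).
Proof.
move=> kb; have /choice[k' k'P] : forall i, exists k', cancel (k i) k' /\ cancel k' (k i).
  by move=> i; have [k' kK k'K] := kb i; exists k'.
exists (fun y i => k' i (y (s i))) => x; apply: funext => i.
  by rewrite permprodE (k'P i).1.
by rewrite /permprod permKV (k'P _).2.
Qed.

Lemma exists_aut d (h : cantor_pow d -> cantor_pow d) : bijective h ->
  (forall f : dV d, exists g : dV d, forall x, g (h x) = h (f x)) ->
  (forall g : dV d, exists f : dV d, forall x, g (h x) = h (f x)) ->
  exists a : aut (dV d), forall f x, a f (h x) = h (f x).
Proof.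
move=> [h' hK h'K] /choice[u uP] /choice[w wP].
have extE (f g : dV d) : (forall x, f (h x) = g (h x)) -> f = g.
  by move=> e; apply: dV_eq => x; rewrite -[x]h'K e.
have uM : {morph u : f g / f * g}.
  by move=> f g; apply: extE => x; rewrite uP /= !uP.
have ub : bijective u.
  exists w => f; last by apply: extE => x; rewrite uP wP.
  by apply: dV_eq => x; apply: (can_inj hK); rewrite -wP uP.
pose B := isMultiplicative.Build (dV d) (dV d) u uM.
pose u' : {multiplicative dV d -> dV d} := HB.pack u B.
by exists (@Aut _ u' ub).
Qed.

(** Precomposing [h] with the embedding [emb] onto the cube at [zeros] gives a product map [F] with
    clopen image. Each factor of [F] is a bijection followed by a parametrization [r j] of its
    image, so [F = R \o H] with [H] a permuted product of bijections and [R] locally a prefix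
    exchange. Then [H] and [h] differ by an element of dV. *)
Lemma product_form d (a : aut (dV d.+1)) : exists (a' : aut (dV d.+1)) k s,
  [/\ inner (a^-1 * a'), forall i, bijective (k i) &
      forall f x, a' f (permprod k s x) = permprod k s (f x)].
Proof.
have [h [h' [hK h'K hc h'c ha]]] := aut_spatial a.
have [N [t tP]] := local_product hK h'K hc h'c ha.
pose emb := splice (fun=> 0%N) (fun=> N) (@zeros d.+1).
have Nemb z : agree N (@zeros d.+1) (emb z) by move=> i k kN; rewrite /emb /splice kN.
have embI : injective emb.
  move=> y z e; apply: cantor_powP => i k.
  have := congr1 (fun w : cantor_pow d.+1 => w i (N + k)%N) e.
  by rewrite /emb /splice ltnNge leq_addr /= addKn.
pose F z := h (emb z); have FI : injective F by apply: inj_comp (can_inj hK) embI.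
pose f j c := F (fun=> c) j.
have FE z j : F z j = f j (z (t j)) by rewrite /f /F (tP _ (Nemb z)) (tP _ (Nemb (fun=> z (t j)))).
(* A coordinate that [t] misses could be altered without changing [F], against injectivity. *)
have tsurj i : exists j, t j = i.
  apply: contrapT => /forallNP no.
  have : F (@zeros d.+1) = F (upd (@zeros d.+1) i (fun=> true)).
    by apply: funext => j; rewrite !FE upd_neq.
  by move/FI/(congr1 (fun z : cantor_pow d.+1 => z i 0%N)); rewrite updE.
have [s0 s0K] := choice tsurj.
pose s := perm (can_inj s0K).
have ts i : t (s i) = i by rewrite permE s0K.
have sVt j : s^-1 j = t j by rewrite -{2}[j](permKV s) ts.
have tI : injective t by move=> j j'; rewrite -!sVt; apply: perm_inj.
have fI j : injective (f j).
  move=> c c' e; pose z c : cantor_pow d.+1 := upd (@zeros d.+1) (t j) c.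
  suff /FI/(congr1 (fun y : cantor_pow d.+1 => y (t j))) : F (z c) = F (z c').
    by rewrite /z !updE.
  apply: funext => j'; rewrite !FE /z; have [->|/eqP ne] := eqVneq j' j.
    by rewrite !updE.
  by rewrite !upd_neq // => /tI.
pose B y := agree N (@zeros d.+1) (h' y).
have BE y : B y <-> exists z, y = F z.
  split=> [By|[z ->]]; last by rewrite /B /F hK.
  exists (fun i k => h' y i (N + k)%N); rewrite /F -[LHS]h'K; congr h.
  apply: cantor_powP => i k; rewrite /emb /splice; case: ltnP => kN.
    by rewrite -By.
  by rewrite add0n subnKC.
have [n nB] : clopen_set B by apply: clopen_set_preim (clopen_set_agree _ _) h'c.
have /choice[r rP] : forall j, exists r, [/\ injective r,
    forall c, (exists c', c = f j c') <-> exists e, c = r e & forall c, prefix1_at r c].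
  move=> j; apply: (@clopen_parametrization n); last by exists (f j (fun=> false)), (fun=> false).
  move=> c c' cc' [c1 ec].
  have /BE[z zE] : B (upd (F (fun=> c1)) j c').
    apply: nB (_ : B (F (fun=> c1))); last by apply/BE; eexists.
    by apply: agree_upd => k kn; rewrite -cc' // ec.
  by exists (z (t j)); rewrite -FE -zE updE.
have /choice[k0 k0P] : forall j, exists k, forall c, f j c = r j (k c).
  move=> j; have [_ rE _] := rP j.
  have /choice[k kP] : forall c, exists e, f j c = r j e by move=> c; apply/rE; exists c.
  by exists k.
pose k i := k0 (s i).
have kb i : bijective (k i).
  apply: inj_surj_bijective => [c c' e|e].
    by apply: (fI (s i)); rewrite !k0P -/(k i) e.
  have [rI rE _] := rP (s i); have /rE[c ec] : exists e', r (s i) e = r (s i) e' by exists e.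
  by exists c; apply: rI; rewrite ec k0P.
pose H := permprod k s; have Hb : bijective H by apply: permprod_bij.
have HE z : F z = fun j => r j (H z j).
  by apply: funext => j; rewrite /H /permprod /k permKV FE sVt k0P.
pose R (z : cantor_pow d.+1) : cantor_pow d.+1 := fun j => r j (z j).
have RI : injective R.
  move=> z z' e; apply: funext => j; have [rI _ _] := rP j.
  exact: rI (congr1 (fun y : cantor_pow d.+1 => y j) e).
have Rl z : prefix_at R z by apply: prefix_at_prod => j; have [] := rP j.
(* Near [y], [R \o (H \o h')] equals [a g], where [g] in dV has the germ of [emb] at [h' y];
   [prefix_at_cancel] removes [R]. *)
have [V VE] : exists V : dV d.+1, forall x, V (h x) = H x.
  have pf : prefix_exchange_map (H \o h').
    apply: prefix_at_dV => [|y]; first by apply: bij_comp Hb _; exists h.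
    have [i k1|g [n1 gE]] := @splice_extend d (fun=> 0%N) (fun=> N) (h' y) (emb (h' y)).
      by rewrite /emb /splice ltnNge leq_addr /= addKn.
    have [m mP] := h'c y n1.
    apply: (@prefix_at_cancel _ R _ (a g) y m) => // [y' /mP yy' /=|]; last exact: dV_prefix_at.
    rewrite -[y' in RHS]h'K ha gE // splice_base.
    exact: esym (HE (h' y')).
  by exists (PrefixExchange pf) => x /=; rewrite hK.
have hsurj y : exists x, y = H x by have [H' _ H'K] := Hb; exists (H' y).
have [|f1|g|a' a'E] := @exists_aut _ H.
- exact: Hb.
- by exists (a f1 ^ V) => x; rewrite -!VE dVJ dVK ha.
- exists ((a^-1 : aut _) (g ^ V^-1)) => x.
  by rewrite -!VE -ha autVK dVJ invgK dVVK.
exists a', k, s; split=> //; exists V => g; apply: dV_eq => y.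
have [x ->] := hsurj y.
by rewrite autME a'E -/H -!VE -ha autVK dVJ dVK.
Qed.

(** * The isomorphism *)

Definition onC (f : cantor_pow 1 -> cantor_pow 1) (c : nat -> bool) : nat -> bool :=
  f (fun=> c) ord0.
Definition ofC (k : (nat -> bool) -> nat -> bool) (x : cantor_pow 1) : cantor_pow 1 :=
  fun i => k (x i).

Lemma cantor_pow1E (x : cantor_pow 1) : x = fun=> x ord0.
Proof. by apply: funext => i; rewrite (ord1 i). Qed.

Lemma onCE f (x : cantor_pow 1) : f x ord0 = onC f (x ord0).
Proof. by rewrite {1}(cantor_pow1E x). Qed.

Lemma onCK f : ofC (onC f) = f.
Proof.
apply: funext => x; rewrite [RHS]cantor_pow1E onCE; apply: funext => i.
by rewrite /ofC (ord1 i).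
Qed.

Lemma onC_ext (f g : dV 1) : onC f =1 onC g -> f = g.
Proof. by move=> e; apply: dV_eq => x; rewrite -[in LHS](onCK f) (funext e) onCK. Qed.

Lemma onCM (f g : dV 1) c : onC (f * g) c = onC g (onC f c).
Proof. by rewrite /onC dVM {1}[f _]cantor_pow1E. Qed.

Lemma onC_dVK (f : dV 1) : cancel (onC f) (onC (f^-1 : dV 1)).
Proof. by move=> c; rewrite -onCM mulgV. Qed.

Lemma onC_dVVK (f : dV 1) : cancel (onC (f^-1 : dV 1)) (onC f).
Proof. by move=> c; rewrite -onCM mulVg. Qed.

Lemma onCJ (f g : dV 1) c : onC (f ^ g) (onC g c) = onC g (onC f c).
Proof. by rewrite !onCM onC_dVK. Qed.

Lemma onC_prefix1_at (f : dV 1) c : prefix1_at (onC f) c.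
Proof.
apply: (@prefix_at_coordinate 1 f (fun=> c) ord0) (dV_prefix_at _ _) => c'.
by rewrite onCE updE.
Qed.

Lemma bijective_ofC k : bijective k -> bijective (ofC k).
Proof. by move=> [k' kK k'K]; exists (ofC k') => x; apply: funext => i; rewrite /ofC ?kK ?k'K. Qed.

Lemma prod_dV d (f : 'I_d -> dV 1) :
  exists F : dV d, forall x, F x = fun i => onC (f i) (x i).
Proof.
have pf : prefix_exchange_map (fun (x : cantor_pow d) i => onC (f i) (x i)).
  apply: prefix_at_dV => [|x]; last by apply: (@prefix_at_prod _ (fun i => onC (f i))) => i; apply: onC_prefix1_at.
  exists (fun x i => onC ((f i)^-1 : dV 1) (x i)) => x; apply: funext => i.
    exact: onC_dVK.
  exact: onC_dVVK.
by exists (PrefixExchange pf).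
Qed.

Lemma dV_coordinate d (F : dV d) i k : bijective k ->
  (forall x, F x i = k (x i)) -> exists f : dV 1, onC f = k.
Proof.
move=> kb Fk.
suff pf : prefix_exchange_map (ofC k) by exists (PrefixExchange pf).
apply: prefix_at_dV => [|x]; first exact: bijective_ofC.
apply: (@prefix_at_prod _ (fun=> k)) => j; pose y : cantor_pow d := fun=> x j.
apply: (@prefix_at_coordinate d F y i k _ (dV_prefix_at F y)) => c.
by rewrite Fk updE.
Qed.

(** Each coordinate of the germ extends to an element of V by [splice_extend]; hence products of
    maps normalizing V can normalize dV. *)
Lemma dV_locally_prod d (f : dV d) x : exists (g : 'I_d -> dV 1) n,
  forall y, agree n x y -> forall i, f y i = onC (g i) (y i).
Proof.
have [a [b [e [n fE]]]] := dV_prefix_at f x.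
have /choice[g /choice[m gm]] : forall i, exists (g : dV 1) m, forall y : cantor_pow 1,
    agree m (fun=> x i) y -> g y = splice (fun=> a i) (fun=> b i) (fun=> f x i) y.
  move=> i; apply: splice_extend => _ k.
  by rewrite fE // /splice ltnNge leq_addr /= addKn.
exists g, (maxn n (\max_i m i)) => y xy i.
rewrite fE ?/onC ?gm //; last by apply: agreeW xy; lia.
  by apply: funext => k; rewrite /splice fE // /splice; case: ltnP.
by move=> j k km; apply: xy; have := le_maxfun m i; lia.
Qed.

(** The quotient of two intertwiners commutes with dV. If it sent [x] to [u] with [u <> x], a flip
    supported near [u] would fix [x] and move [u]. *)
Lemma intertwiner_unique d (a : aut (dV d.+1)) (h1 h2 : cantor_pow d.+1 -> cantor_pow d.+1) :
  bijective h2 -> (forall f x, a f (h1 x) = h1 (f x)) ->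
  (forall f x, a f (h2 x) = h2 (f x)) -> h1 = h2.
Proof.
move=> [h2' h2K h2'K] a1 a2; apply: funext => x; rewrite -[LHS]h2'K; congr h2.
apply: contrapT => ne; set u := h2' _ in ne.
have [n nP] := neq_agree ne.
have [f fE _] := @flip_dV d n (agree n u) (fun y z yz uy => agree_trans uy yz).
have fx : f x = x by rewrite fE flip_id.
have fu : f u <> u by rewrite fE; apply: flip_neq.
by apply: fu; apply: (can_inj h2K); rewrite -a2 /u h2'K a1 fx.
Qed.

Local Open Scope quotient_scope.
Definition outer (G : groupType) (a : aut G) : Out G := \pi_(Out G) a.
Local Close Scope quotient_scope.

Lemma onC_intertwine (f g : dV 1) k :
  (forall x, g (ofC k x) = ofC k (f x)) <-> (forall c, onC g (k c) = k (onC f c)).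
Proof.
split=> [gk c|gk x]; first by have := congr1 (fun x : cantor_pow 1 => x ord0) (gk (fun=> c)).
rewrite [LHS]cantor_pow1E [RHS]cantor_pow1E onCE /ofC gk.
by rewrite -onCE.
Qed.

(** * Outer classes and elements of the wreath product *)

Section Outer.
Variable G : groupType.
Implicit Types a b : aut G.

Lemma outerM a b : outer (a * b) = outer a * outer b.
Proof. exact: pi_OutM. Qed.

Lemma outerP a b : outer a = outer b <-> inner (a^-1 * b).
Proof. by split=> [/OutP/asboolP|i] //; apply/OutP/asboolP. Qed.

Lemma outer_surj (p : Out G) : exists a, outer a = p.
Proof. by exists (generic_quotient.repr p); apply: reprK. Qed.

End Outer.

(* The i-th factor of [permprod k s] reads coordinate i and writes coordinate  *)
(* s i, which makes [realizes] multiplicative for the product of the wreath    *)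
(* product.                                                                    *)
Definition realizes d (a : aut (dV d)) (p : wreath (Out V) d) :=
  exists k (b : 'I_d -> aut V),
    [/\ forall i, bijective (k i), forall i, outer (b i) = p.1 i,
        forall i (f : V) c, onC (b i f) (k i c) = k i (onC f c) &
        forall f x, a f (permprod k p.2 x) = permprod k p.2 (f x)].

Lemma realizesM d (a a' : aut (dV d)) p p' :
  realizes a p -> realizes a' p' -> realizes (a * a') (p * p').
Proof.
move=> [k [b [kb bp bk ak]]] [k' [b' [kb' bp' bk' ak']]].
have permprodM x : permprod (fun i c => k' (p.2 i) (k i c)) (p.2 * p'.2) x =
    permprod k' p'.2 (permprod k p.2 x).
  apply: funext => j; rewrite -[j](permKV (p.2 * p'.2)) permprodE.
  by rewrite permM !permprodE.
exists (fun i c => k' (p.2 i) (k i c)), (fun i => b i * b' (p.2 i)); split.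
- by move=> i; apply: bij_comp (kb' _) (kb i).
- by move=> i; rewrite outerM bp bp' /= !ffunE.
- by move=> i f c; rewrite autME bk' bk.
- by move=> f x; rewrite !permprodM autME ak' ak.
Qed.

(** Each factor [k i] normalizes V: an element of V placed in coordinate [i] alone lies in dV, and
    its image under [a'] acts in coordinate [s i] as the conjugate by [k i], which is in V by
    [dV_coordinate]. The inverse of [a'] gives the other direction. *)
Lemma realizes_total d (a : aut (dV d.+1)) :
  exists p a', outer a' = outer a /\ realizes a' p.
Proof.
have [a' [k [s [aa' kb a'E]]]] := product_form a.
suff /choice[b bE] : forall i, exists b : aut V,
    forall (f : V) c, onC (b f) (k i c) = k i (onC f c).
  exists ([ffun i => outer (b i)], s), a'; split.
    exact/esym/outerP.
  by exists k, b; split => // i; rewrite ffunE.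
move=> i; have [k' kK k'K] := kb i.
pose single (j : 'I_d.+1) (f : dV 1) l : dV 1 := if l == j then f else 1.
have [|f|g|b bE] := @exists_aut 1 (ofC (k i)); first exact: bijective_ofC.
- have [F FE] := prod_dV (single i f).
  have [||g gE] := @dV_coordinate _ (a' F) (s i) (k i \o onC f \o k').
  + apply: bij_comp; last by exists (k i).
    by apply: bij_comp (kb i) _; exists (onC (f^-1 : dV 1)); [apply: onC_dVK | apply: onC_dVVK].
  + move=> y; have [H' HK H'K] := permprod_bij s kb; rewrite -[y]H'K.
    by rewrite a'E !permprodE FE /single eqxx /= kK.
  exists g; apply/onC_intertwine => c.
  by rewrite gE /= kK.
- have [F FE] := prod_dV (single (s i) g).
  have [||f fE] := @dV_coordinate _ ((a'^-1 : aut _) F) i (k' \o onC g \o k i).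
  + apply: bij_comp (kb i); apply: bij_comp; first by exists (k i).
    by exists (onC (g^-1 : dV 1)); [apply: onC_dVK | apply: onC_dVVK].
  + move=> x; apply: (can_inj kK); rewrite /= k'K -!(permprodE k s).
    by rewrite -a'E autVK FE /single eqxx.
  exists f; apply/onC_intertwine => c.
  by rewrite fE /= k'K.
by exists b => f; apply/onC_intertwine/bE.
Qed.

(** Equal outer classes make [k' i] and [k i] differ by an element of V, by [intertwiner_unique];
    the product of these elements is in dV and conjugates one automorphism into the other. *)
Lemma realizes_outer_inj d (a a' : aut (dV d.+1)) p :
  realizes a p -> realizes a' p -> outer a = outer a'.
Proof.
move=> [k [b [kb bp bk ak]]] [k' [b' [kb' bp' bk' ak']]].
have /choice[g gP] : forall i, exists g : dV 1, forall c, k' i c = onC g (k i c).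
  move=> i; have /outerP[g bg] : outer (b i) = outer (b' i) by rewrite bp bp'.
  have b'E f : b' i f = b i f ^ g by rewrite -bg autME autKV.
  exists g => c.
  have e : ofC (k' i) = g \o ofC (k i).
    apply: (@intertwiner_unique 0 (b' i)).
    - apply: bij_comp; last exact: bijective_ofC.
      by exists (g^-1 : dV 1); [apply: dVK | apply: dVVK].
    - by move=> f; apply/onC_intertwine/bk'.
    - move=> f x; rewrite b'E.
      change (g (b i f ((g^-1 : dV 1) (g (ofC (k i) x)))) = g (ofC (k i) (f x))).
      rewrite dVK; congr (g _).
      by move: x; apply/onC_intertwine/bk.
  exact: (congr1 (fun u => onC u c) e).
have [G GE] := prod_dV (fun j => g (p.2^-1 j)).
have k'E x : permprod k' p.2 x = G (permprod k p.2 x).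
  by rewrite GE; apply: funext => j; rewrite /permprod gP.
apply/outerP; exists G => f; apply: dV_eq => y.
have [H' _ H'K] := permprod_bij p.2 kb'; rewrite -[y]H'K autME ak' !k'E.
by rewrite dVJ dVK -ak autVK.
Qed.

Lemma splice_inj_coordinate d a b (e x y : cantor_pow d) n i : agree n x y ->
  (a i <= n)%N -> splice a b e x i = splice a b e y i -> x i = y i.
Proof.
move=> xy an xyE; apply: funext => k; have [ka|ak] := ltnP k (a i).
  by rewrite xy //; lia.
have := congr1 (fun c => c (b i + (k - a i))%N) xyE.
by rewrite /splice ltnNge leq_addr /= addKn subnKC.
Qed.

Lemma realizes_fun d (a a' : aut (dV d.+1)) p p' :
  realizes a p -> realizes a' p' -> outer a = outer a' -> p = p'.
Proof.
move: p p' => [A s] [A' s'] [k [b [kb bp bk ak]]] [k' [b' [kb' bp' bk' ak']]].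
move=> /outerP[g ag]; rewrite /= in bp ak bp' ak'.
have a'E f : a' f = a f ^ g by rewrite -ag autME autKV.
have [H' HK H'K] := permprod_bij s kb.
have gE x : permprod k' s' x = g (permprod k s x).
  have e : permprod k' s' = g \o permprod k s.
    apply: (@intertwiner_unique d a') => //.
      apply: bij_comp; last exact: permprod_bij.
      by exists (g^-1 : dV _); [apply: dVK | apply: dVVK].
    by move=> f y; rewrite a'E dVJ /comp dVK ak.
  by rewrite e.
(* Change only coordinate [j] of [y] to get [w]. If the permutations differed at [j], coordinate [j]
   of [g] would not notice the change, whereas a germ of dV is injective in each coordinate. *)
have sE : s^-1 = s'^-1.
  apply/permP => j; apply/eqP; apply: contraT => /eqP ne; exfalso.
  pose x := @zeros d.+1; pose y := permprod k s x.
  have [a0 [b0 [e0 [n gyE]]]] := dV_prefix_at g y.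
  have [z yz zj] := exists_agree_neq (maxn n (a0 j)) y j; apply: zj.
  have yw : agree (maxn n (a0 j)) y (upd y j (z j)).
    by apply: agree_upd => r rn; rewrite yz.
  set w := upd _ _ _ in yw.
  have xw : H' w (s'^-1 j) = x (s'^-1 j).
    apply: (bij_inj (kb (s'^-1 j))); rewrite -!(permprodE k s) H'K /w upd_neq // => e.
    by apply: ne; rewrite -{1}e permK.
  rewrite -(updE y j (z j)); apply: esym.
  apply: (splice_inj_coordinate (a := a0) (b := b0) (e := e0) yw); first exact: leq_maxr.
  rewrite -!gyE //; last by apply: agreeW yw; lia.
  by rewrite -/w -[w]H'K -!gE /permprod xw.
have {}sE : s' = s by apply: invg_inj.
subst s'; congr (_, _); apply/ffunP => i; rewrite -bp -bp'; apply/outerP.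
have [k1 kK k1K] := kb i.
have [||r rE] := @dV_coordinate _ g (s i) (k' i \o k1).
- by apply: bij_comp (kb' i) _; exists (k i).
- by move=> y; rewrite -[y]H'K -gE !permprodE /= kK.
have k'E c : k' i c = onC r (k i c) by rewrite rE /= kK.
exists r => f; apply: onC_ext => c.
have [k2 _ k2K] := kb' i; rewrite -[c]k2K autME bk' !k'E onCJ -bk.
by rewrite autVK.
Qed.

(** Represent each class by an automorphism [b i] of V and take its homeomorphism. The permuted
    product [H] normalizes dV: conjugating by it, in either direction, turns a local product of
    elements of V into another, with factors obtained from the [b i] or their inverses. *)
Lemma realizes_surj d (p : wreath (Out V) d.+1) : exists a : aut (dV d.+1), realizes a p.
Proof.
have /choice[b bp] : forall i, exists b : aut V, outer b = p.1 i.
  by move=> i; apply: outer_surj.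
have /choice[h /choice[h' hP]] := fun i => aut_spatial (b i : aut (dV 1)).
pose k i := onC (h i); pose k' i := onC (h' i).
have onCK2 (u v : cantor_pow 1 -> cantor_pow 1) : cancel u v -> cancel (onC u) (onC v).
  by move=> uv c; rewrite /onC -cantor_pow1E uv.
have kK i : cancel (k i) (k' i) by have [hK _ _ _ _] := hP i; apply: onCK2.
have k'K i : cancel (k' i) (k i) by have [_ hK _ _ _] := hP i; apply: onCK2.
have kb i : bijective (k i) by exists (k' i).
have bk i (f : V) c : onC (b i f) (k i c) = k i (onC f c).
  have [_ _ _ _ bh] := hP i; move: c; apply/onC_intertwine => x.
  by rewrite /k onCK bh.
pose H := permprod k p.2; pose H' (y : cantor_pow d.+1) i := k' i (y (p.2 i)).
have Hb : bijective H by apply: permprod_bij.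
have HK : cancel H H' by move=> x; apply: funext => i; rewrite /H' /H permprodE kK.
have H'K : cancel H' H by move=> y; apply: funext => j; rewrite /H /permprod /H' k'K permKV.
have onC_cont (u : 'I_d.+1 -> cantor_pow 1 -> cantor_pow 1) (x : cantor_pow d.+1) n :
    (forall i y, continuous_at (u i) y) -> exists m, forall y, agree m x y ->
    forall i, agree n (fun=> onC (u i) (x i)) (fun _ : 'I_1 => onC (u i) (y i)).
  move=> uc; have /choice[m mP] := fun i => uc i (fun=> x i) n.
  exists (\max_i m i)%N => y xy i j r rn; apply: (mP i) => // l q qm.
  by apply: xy; have := le_maxfun m i; lia.
have Hc x : continuous_at H x.
  move=> n; have [|m mP] := onC_cont h x n; first by move=> i; have [] := hP i.
  by exists m => y /mP xy j r rn; apply: (xy _ ord0).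
have H'c y : continuous_at H' y.
  move=> n; have [|m mP] := onC_cont h' (fun i => y (p.2 i)) n; first by move=> i; have [] := hP i.
  exists m => z yz i r rn; apply: (mP (fun i => z (p.2 i)) _ i ord0) => // l q qm.
  exact: yz.
have [//|f|g|a aE] := @exists_aut _ H.
- have pf : prefix_exchange_map (H \o f \o H').
    apply: prefix_at_dV => [|y].
      apply: bij_comp; last by exists H.
      by apply: bij_comp Hb _; exists (f^-1 : dV _); [apply: dVK | apply: dVVK].
    have [u [n fE]] := dV_locally_prod f (H' y).
    have [m mP] := H'c y n.
    have [F FE] := prod_dV (fun j => b (p.2^-1 j) (u (p.2^-1 j)) : dV 1).
    apply: (prefix_at_near (n := m) _ (dV_prefix_at F y)) => z /mP yz.
    rewrite FE -[z in RHS]H'K; apply: funext => j /=.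
    by rewrite /H /permprod fE // bk.
  by exists (PrefixExchange pf) => x /=; rewrite HK.
- have pf : prefix_exchange_map (H' \o g \o H).
    apply: prefix_at_dV => [|x].
      apply: bij_comp Hb; apply: bij_comp; first by exists H.
      by exists (g^-1 : dV _); [apply: dVK | apply: dVVK].
    have [u [n gE]] := dV_locally_prod g (H x).
    have [m mP] := Hc x n.
    have [F FE] := prod_dV (fun i => ((b i)^-1 : aut V) (u (p.2 i)) : dV 1).
    apply: (prefix_at_near (n := m) _ (dV_prefix_at F x)) => z /mP xz.
    rewrite FE; apply: funext => i /=; apply: (can_inj (kK i)).
    by rewrite {1}/H' k'K gE // /H permprodE -bk autVK.
  by exists (PrefixExchange pf) => x /=; rewrite H'K.
by exists a, k, b; split.
Qed.

Theorem theorem1p1 (d : nat) (hd : (1 <= d)%N) :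
  exists f : {multiplicative Out (dV d) -> wreath (Out V) d}, bijective f.
Proof.
case: d hd => // d _.
(* The value is chosen through some representative; [FE] shows that any realizing representative
   gives the same one. *)
have /choice[F FP] : forall o : Out (dV d.+1), exists p, exists2 a, outer a = o & realizes a p.
  move=> o; have [a <-] := outer_surj o.
  by have [p [a' [aa' a'p]]] := realizes_total a; exists p, a'.
have FE o a p : outer a = o -> realizes a p -> F o = p.
  by have [a' <- a'p] := FP o => aa' ap; apply: realizes_fun a'p ap (esym aa').
have FM : {morph F : o o' / o * o'}.
  move=> o o'; have [a ao ap] := FP o; have [a' ao' ap'] := FP o'.
  by apply: (FE _ (a * a')); [rewrite outerM ao ao' | apply: realizesM].
have Fb : bijective F.
  apply: inj_surj_bijective => [o o' e|p].
    have [a ao ap] := FP o; have [a' ao' ap'] := FP o'.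
    by rewrite -ao -ao'; rewrite -e in ap'; apply: realizes_outer_inj ap ap'.
  by have [a ap] := realizes_surj p; exists (outer a); apply: FE ap.
pose B := isMultiplicative.Build (Out (dV d.+1)) (wreath (Out V) d.+1) F FM.
pose F' : {multiplicative Out (dV d.+1) -> wreath (Out V) d.+1} := HB.pack F B.
by exists F'.
Qed.
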